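(* Let $X$ be a Lévy process with finite mean, $q_u,q_d>0$, $\epsilon>0$, $\delta>0$, and let $c$ be a cost function with associated function $c_\delta$. Suppose there is a convex function $u:\mathbb R\to\mathbb R$ in the domain of the infinitesimal generator $\mathcal L$ of $X$ such that $$\mathcal Lu(x)-\epsilon u(x)+c_\delta(x)\ge0,\qquad -q_u\le u'(x)\le q_d,\qquad\text{for all }x\in\mathbb R,$$ such that $u$ is linear outside some interval, and such that $u\in C^2(\mathbb R)$ if $X$ has unbounded variation, while $u\in C^1(\mathbb R)$ if $X$ has bounded variation. Then, for every $x\in\mathbb R$, $$u(x)\le\mathbf E_x\Big(\int_{(0,\infty)}e^{-\epsilon s}\big(c_\delta(X^{U,D}_s)ds+q_u\,dU_s+q_d\,dD_s\big)+q_uu_0+q_dd_0\Big)$$ for all controlled processes $X^{U,D}$, $(U,D)\in\mathcal A$, that satisfy $$\mathbf E_x\int_0^\infty e^{-\epsilon s}u(X^{U,D}_s)\,ds<\infty.$$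
   Context: Lévy process. $X=\{X_t\}_{t\ge0}$ is a real-valued Lévy process with finite mean on a filtered probability space $(\Omega,\mathcal F,\mathbf F=(\mathcal F_t)_{t\ge0},\mathbf P_x)$ with right-continuous complete filtration, with $X_0=x$ under $\mathbf P_x$; $\mathbf E_x$ is the expectation under $\mathbf P_x$. Its infinitesimal generator is $\mathcal Lf(x)=\lim_{t\to0}\frac{\mathbf E_xf(X_t)-f(x)}{t}$, defined for every real function $f$ such that the limit exists for every $x\in\mathbb R$; such $f$ are said to be in the domain of the infinitesimal generator. A function $u$ is linear outside an interval $[a,b]$ when it is differentiable on $(a,b)^c$ and $u'(x)=u'(a)$ for all $x\le a$, $u'(x)=u'(b)$ for all $x\ge b$. Controls. An admissible control is a pair $(U,D)$ of non-negative $\mathbf F$-adapted processes, right-continuous and nondecreasing a.s., with $U_t,D_t$ of finite expectation for each $t\ge0$; $\mathcal A$ is the set of admissible controls. The controlled process is $X^{U,D}_t=X_t+U_t-D_t$, with $X_0=x$, $U_0=u_0$, $D_0=d_0$. Cost function. A cost function is a convex function $c:\mathbb R\to[0,\infty)$ such that (i) $c$ reaches its minimum at $0$; (ii) there are constants $\alpha\ge0$, $M\ge0$, $N>0$ with $c(x)+M\ge N|x|^{1+\alpha}$ for all $x$; (iii) for every $\delta>0$ there is a convex $c_\delta\in C^2(\mathbb R)$ with minimum at zero, $\|c-c_\delta\|_\infty<\delta$, and $\mathbf E_x\int_0^\infty|c_\delta'(X_s)|e^{-\epsilon s}ds<\infty$ for every $\epsilon>0$, $x\in\mathbb R$. The function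 $c_\delta$ is the function associated with $c$ and $\delta$. *)

(* Defs.v *)
From HB Require Import structures.
From mathcomp Require Import all_boot all_order all_algebra.
From mathcomp Require Import all_classical all_reals all_analysis.
Set Implicit Arguments.
Unset Strict Implicit.
Unset Printing Implicit Defensive.
Import Order.TTheory GRing.Theory Num.Theory.
Import numFieldNormedType.Exports.
Local Open Scope classical_set_scope.
Local Open Scope ring_scope.

(* Time is the half-line [0, +oo[ of R.  Processes are functions R -> Omega -> R
   and filtrations are functions R -> set (set Omega); their values at negative
   times play no role. *)

Section real_functions.
Context {R : realType}.
Implicit Types f u : R -> R.

Definition class_C (n : nat) f : Prop :=
  (forall k, (k < n)%N -> forall x, derivable (derive1n k f) x 1) /\
  continuous (derive1n n f).

Definition convex_on_R f : Prop :=
  convex_function [set: R^o] (f : R^o -> R^o).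

Definition linear_outside_itv u (a b : R) : Prop :=
  [/\ a <= b,
      forall x, ~ (a < x < b) -> derivable u x 1,
      forall x, x <= a -> derive1 u x = derive1 u a &
      forall x, b <= x -> derive1 u x = derive1 u b].

Definition linear_outside_some_itv u : Prop :=
  exists a b, linear_outside_itv u a b.

Definition sup_norm f : \bar R := ereal_sup [set (`|f x|)%:E | x in setT].

End real_functions.

Section paths.
Context {R : realType}.
Implicit Types g : R -> R.

Definition nondecreasing_path g : Prop :=
  forall s t, 0 <= s -> s <= t -> g s <= g t.

Definition right_continuous_path g : Prop :=
  forall t, 0 <= t -> g x @[x --> t^'+] --> g t.

Definition cadlag_path g : Prop :=
  right_continuous_path g /\ (forall t, 0 < t -> cvg (g x @[x --> t^'-])).

Definition bounded_variation_path g : Prop :=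
  forall t, 0 <= t -> bounded_variation 0 t g.

(* Extension by g 0 to negative times: its Lebesgue-Stieltjes measure is carried
   by ]0, +oo[ and gives `]s, t] the mass g t - g s when 0 <= s <= t. *)
Definition path_extension g : R -> R := fun t => g (Order.max 0 t).

Lemma path_extension_nondecreasing g :
  nondecreasing_path g -> {homo path_extension g : x y / x <= y}.
Proof.
move=> ndg x y xy; apply: ndg; first by rewrite le_max lexx.
by rewrite ge_max !le_max lexx xy orbT.
Qed.

Lemma path_extension_right_continuous g :
  right_continuous_path g -> right_continuous (path_extension g).
Proof.
move=> rcg t; rewrite /path_extension.
have [t0|t0] := leP 0 t.
  apply: cvg_trans (rcg t t0); apply: near_eq_cvg.
  near=> x; congr g; apply/esym/max_idPr; apply: le_trans t0 _.
  by near: x; exact: nbhs_right_ge.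
apply: cvg_trans (@cvg_cst _ (g 0) _ t^'+ _).
apply: near_eq_cvg; near=> x; congr g; apply/esym/max_idPl.
by near: x; exact: nbhs_right_le.
Unshelve. all: by end_near. Qed.

Section dpath.
Variables (g : R -> R) (ndg : nondecreasing_path g)
  (rcg : right_continuous_path g).

HB.instance Definition _ := isCumulative.Build R _ R (path_extension g)
  (path_extension_nondecreasing ndg) (path_extension_right_continuous rcg).

Definition dpath : {measure set (measurableTypeR R) -> \bar R} :=
  lebesgue_stieltjes_measure (path_extension g).

End dpath.

(* The integral of h dg over ]0, +oo[.  The paths of a control are nondecreasing
   and right-continuous only almost surely, hence the default value 0. *)
Definition stieltjes_integral g (h : R -> R) : \bar R :=
  match pselect (nondecreasing_path g /\ right_continuous_path g) with
  | left H => (\int[dpath H.1 H.2]_(s in `]0%R, +oo[) (h s)%:E)%E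
  | right _ => 0%E
  end.

End paths.

Section processes.
Context {d : measure_display} {Omega : measurableType d} {R : realType}.
Implicit Types (P : R -> probability Omega R) (F : R -> set (set Omega))
  (X : R -> Omega -> R).

(* The laws P x are mutually singular (X 0 = x almost surely under P x), and
   completing one sigma-algebra for each of them separately would make F 0
   contain all sets.  As is usual for such a family, completeness refers to the
   sets that are negligible under every P x. *)
Record filtration P F : Prop := {
  filtration_sigma : forall t, 0 <= t -> sigma_algebra setT (F t);
  filtration_sub : forall t, 0 <= t -> F t `<=` measurable;
  filtration_nd : forall s t, 0 <= s -> s <= t -> F s `<=` F t;
  filtration_rc : forall t, 0 <= t ->
    F t = \bigcap_(s in [set s | t < s]) F s;
  filtration_complete : forall N : set Omega,
    (forall x, (P x).-negligible N) -> F 0 N }.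

Definition adapted F X : Prop :=
  forall t, 0 <= t -> forall B : set R, measurable B -> F t (X t @^-1` B).

Definition increment X (s t : R) : Omega -> R := fun w => X t w - X s w.

(* P x is the law of the process started at x; the increments have the same law
   under all the P x. *)
Record levy_process P F X : Prop := {
  levy_adapted : adapted F X;
  levy_start : forall x, {ae P x, forall w, X 0 w = x};
  levy_cadlag : forall x, {ae P x, forall w, cadlag_path (X ^~ w)};
  levy_independent : forall x s t, 0 <= s -> s <= t ->
    forall (A : set Omega) (B : set R), F s A -> measurable B ->
    P x (A `&` increment X s t @^-1` B) =
      (P x A * P x (increment X s t @^-1` B))%E;
  levy_stationary : forall x y s t, 0 <= s -> s <= t ->
    forall B : set R, measurable B ->
    P x (increment X s t @^-1` B) = P y (increment X 0 (t - s) @^-1` B) }.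

Definition finite_mean P X : Prop :=
  forall x t, 0 <= t -> (P x).-integrable setT (EFin \o X t).

Definition has_bounded_variation P X : Prop :=
  forall x, {ae P x, forall w, bounded_variation_path (X ^~ w)}.

Definition generator_quotient P X (f : R -> R) (x t : R) : R :=
  (fine 'E_(P x)[fun w => f (X t w)] - f x) / t.

Definition generator P X (f : R -> R) (x : R) : R :=
  lim (generator_quotient P X f x t @[t --> 0^'+]).

Definition in_generator_domain P X (f : R -> R) : Prop :=
  forall x,
    (\forall t \near 0^'+,
       (P x).-integrable setT (fun w => (f (X t w))%:E)) /\
    cvg (generator_quotient P X f x t @[t --> 0^'+]).

Record control_component F (Q : probability Omega R) (U : R -> Omega -> R) :
    Prop := {
  control_ge0 : forall t w, 0 <= t -> 0 <= U t w;
  control_adapted : adapted F U;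
  control_right_continuous : {ae Q, forall w, right_continuous_path (U ^~ w)};
  control_nondecreasing : {ae Q, forall w, nondecreasing_path (U ^~ w)};
  control_integrable : forall t, 0 <= t -> Q.-integrable setT (EFin \o U t) }.

Definition admissible_control F (Q : probability Omega R)
    (U D : R -> Omega -> R) : Prop :=
  control_component F Q U /\ control_component F Q D.

Definition controlled_process X (U D : R -> Omega -> R) : R -> Omega -> R :=
  fun t w => X t w + U t w - D t w.

Record associated_function P X (c : R -> R) (delta : R) (cdelta : R -> R) :
    Prop := {
  associated_convex : convex_on_R cdelta;
  associated_C2 : class_C 2 cdelta;
  associated_min : forall x, cdelta 0 <= cdelta x;
  associated_close : (sup_norm (fun x => (c x - cdelta x)%R) < delta%:E)%E;
  associated_integrable : forall eps x : R, 0 < eps ->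
    (\int[P x]_w \int[lebesgue_measure]_(s in `[0%R, +oo[)
       (`|derive1 cdelta (X s w)| * expR (- eps * s))%:E < +oo)%E }.

Record cost_function P X (c : R -> R) : Prop := {
  cost_ge0 : forall x, 0 <= c x;
  cost_convex : convex_on_R c;
  cost_min : forall x, c 0 <= c x;
  cost_growth : exists alpha M N : R, [/\ 0 <= alpha, 0 <= M, 0 < N &
    forall x, N * `|x| `^ (1 + alpha) <= c x + M];
  cost_approx : forall delta, 0 < delta ->
    exists cdelta, associated_function P X c delta cdelta }.

(* The initial values u_0 and d_0 of the control are U 0 and D 0; the jump from
   0- to 0 is charged by the last term, the Stieltjes integrals being over
   ]0, +oo[. *)
Definition discounted_cost (Q : probability Omega R) X (eps qu qd : R)
    (c : R -> R) (U D : R -> Omega -> R) : \bar R :=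
  (\int[Q]_w
     (\int[lebesgue_measure]_(s in `]0%R, +oo[)
         (expR (- eps * s) * c (controlled_process X U D s w))%:E
      + qu%:E * stieltjes_integral (U ^~ w) (fun s => expR (- eps * s))
      + qd%:E * stieltjes_integral (D ^~ w) (fun s => expR (- eps * s))
      + (qu * U 0%R w + qd * D 0%R w)%:E))%E.

End processes.

(* Main.v *)
From HB Require Import structures.
Require Import Defs.
From mathcomp Require Import all_boot all_order all_algebra.
From mathcomp Require Import all_classical all_reals all_analysis.
From mathcomp Require Import measurable_realfun lra ring.
Import Order.TTheory GRing.Theory Num.Theory.
Import numFieldNormedType.Exports.
Local Open Scope classical_set_scope.
Local Open Scope ring_scope.

(* Put V = u(X^{U,D}) + qu U + qd D.  The slope bounds on u say that V does not
   decrease when the control acts, so by independence of the increments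
     E V_{t+h} >= E V_t + E (P_h u - u)(X^{U,D}_t),
   where P_h u(y) = E_0 u(y + X_h - X_0).  Integrate this against
   eps e^{-eps t} dt, use translation invariance of Lebesgue measure on the left,
   divide by h = 1/n and let n -> oo.  Convexity of u gives
   (P_h u - u)/h >= -K (a tangent line only sees the mean of the increment), so
   that Fatou's lemma applies and replaces the quotient by L u >= eps u - c.
   The Stieltjes integrals enter through
     int_{]0,oo[} e^{-eps s} dU_s = eps int_0^oo e^{-eps s} (U_s - U_0) ds.
   When the cost is finite so is E int e^{-eps s} (U_s + D_s) ds, which makes all
   the terms integrable; if it is infinite there is nothing to prove. *)
Set Implicit Arguments.
Unset Strict Implicit.
Unset Printing Implicit Defensive.

(** * Convex functions with bounded slope *)

(** Three obstacles shape the proof. Path regularity is only almost sure, under the single law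
    [P x], whereas Fubini wants joint measurability in time and sample point. Paths are therefore
    set to zero on a null set [N]; but [N] need not belong to the filtration, so independence of the
    increments is applied to the original adapted process, and the modified one is compared with it
    almost surely. Next, a finite mean makes E|X_t - X_0| finite for each t without any uniformity
    in t, while discounted integrals need a growth bound. The function t -> E|X_t - X_0| is
    measurable and subadditive; a Steinhaus-type argument makes it locally bounded, hence of linear
    growth. Finally, the smooth cost may be negative. It is at least -delta, so delta is added to
    the running cost and delta / eps subtracted from the discounted total, which keeps Tonelli
    available even for infinite values. The discount, once normalised, is the exponential law: a
    probability on times that can be a factor of a product measure, and whose tail at s is exactly
    e^{-eps s}. *)

Section convex.
Context {R : realType}.
Variable u : R -> R.
Hypotheses (cu : convex_on_R u) (du : forall x, derivable u x 1).

Lemma convex_tangent (y z : R) : u y + derive1 u y * (z - y) <= u z.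
Proof.
have dif : differentiable (u : R^o -> R^o) y by apply/derivable1_diffP; exact: du.
have E : 'D_(z - y) (u : R^o -> R^o) y = derive1 u y * (z - y).
  by rewrite deriveE// diff1E//= mulrC.
rewrite -lerBrDl -E.
have /cvg_dnbhs_at_right := @diff_derivable _ _ _ (u : R^o -> R^o) y (z - y) dif.
rewrite -[lim _]/('D_(z - y) (u : R^o -> R^o) y) => dv.
rewrite -(cvg_lim (@Rhausdorff R) dv).
(* For 0 < h <= 1 convexity bounds the quotient at step [h] in the direction [z - y] by the whole
   chord [u z - u y], and the bound passes to the derivative. *)
apply: limr_le; first by apply/cvg_ex; eexists; exact: dv.
near=> h; rewrite /= /GRing.scale /=.
have h0 : 0 < h by near: h; exact: nbhs_right_gt.
have h1 : h <= 1 by near: h; apply: nbhs_right_le.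
have hi : Itv.spec (@Itv.num_sem R) (Itv.Real `[0%Z, 1%Z]) h.
  by rewrite /Itv.num_sem /= in_itv /= (ltW h0) h1 num_real.
have := @cu (Itv.mk hi) (z : R^o) (y : R^o); rewrite !inE => /(_ I I).
rewrite !convRE /unstable.onem/= => H.
rewrite ler_pdivrMl//; apply: le_trans (_ : h * u z + (1 - h) * u y - u y <= _); last first.
  by rewrite le_eqVlt; apply/orP; left; apply/eqP; ring.
rewrite lerD2r; apply: le_trans H; rewrite le_eqVlt; apply/orP; left; apply/eqP.
congr u; rewrite /= /GRing.scale /= -[conv _ _ _]/(h * z + (1 - h) * y); ring.
Unshelve. all: by end_near. Qed.

Variables qu qd : R.
Hypothesis (hs : forall x, - qu <= derive1 u x <= qd).

(** The push up by [a] is estimated with the tangent at [y], of slope at least [- qu], and the push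
    down by [b] with the tangent at [y + a], of slope at most [qd]. *)
Lemma slope_lower (y a b : R) : 0 <= a -> 0 <= b ->
  u y - qu * a - qd * b <= u (y + a - b).
Proof.
move=> a0 b0.
have /andP[s1 _] := hs y; have /andP[_ s2] := hs (y + a).
have t1 := convex_tangent y (y + a).
have t2 := convex_tangent (y + a) (y + a - b).
have := ler_wpM2r a0 s1; have := ler_wpM2r b0 s2.
by lra.
Qed.

Lemma slope_lip : 0 < qu -> 0 < qd -> forall y z, `|u z - u y| <= (qu + qd) * `|z - y|.
Proof.
move=> qu0 qd0 y z.
have H a b : u b <= u a + (qu + qd) * `|a - b|.
  have := @convex_tangent b a; have /andP[s1 s2] := hs b.
  have : - (derive1 u b * (a - b)) <= `|derive1 u b| * `|a - b|.
    by rewrite -normrM -normrN ler_norm.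
  have : `|derive1 u b| * `|a - b| <= (qu + qd) * `|a - b|.
    by apply: ler_wpM2r => //; rewrite ler_norml; lra.
  by lra.
rewrite ler_norml; have := H z y; have := H y z; rewrite (distrC y z); lra.
Qed.

End convex.

(** * Measure-theoretic preliminaries *)

Section integral_monotone.
Context {d : measure_display} {T : measurableType d} {R : realType}.
Variable mu : {measure set T -> \bar R}.
Local Open Scope ereal_scope.

(* The integral of a nonnegative function is a supremum over simple functions
   below it, so that monotonicity needs no measurability. *)
Lemma le_integral_pointwise (f g : T -> \bar R) :
  (forall x, f x <= g x) -> \int[mu]_x f x <= \int[mu]_x g x.
Proof.
move=> fg.
have H (p q : T -> \bar R) : (forall x, 0 <= p x) -> (forall x, p x <= q x) ->
    \int[mu]_x p x <= \int[mu]_x q x.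
  move=> p0 pq.
  have q0 x : 0 <= q x by exact: le_trans (p0 x) (pq x).
  rewrite !ge0_integralTE//; apply: ereal_sup_le => _ [h /= hp <-].
  by exists h => //= x; exact: le_trans (hp x) (pq x).
rewrite integralE [leRHS]integralE; apply: leeB; apply: H => x.
- exact: funepos_ge0.
- by rewrite !funeposE ge_max !le_max lexx orbT fg.
- exact: funeneg_ge0.
- by rewrite !funenegE ge_max !le_max lexx orbT leeN2 fg.
Qed.

End integral_monotone.

Section integral_comparison.
Context {d : measure_display} {T : measurableType d} {R : realType}.
Variable mu : {measure set T -> \bar R}.

Lemma ae_le_Rintegral (N : set T) (f g : T -> R) : measurable N -> mu N = 0 ->
  mu.-integrable setT (EFin \o f) -> mu.-integrable setT (EFin \o g) ->
  (forall x, ~ N x -> f x <= g x) -> \int[mu]_x f x <= \int[mu]_x g x.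
Proof.
move=> mN N0 fi gi fg.
have DE h : mu.-integrable setT (EFin \o h) ->
    \int[mu]_x h x = \int[mu]_(x in setT `\` N) h x.
  by move=> hi; rewrite /Rintegral (negligible_integral mN measurableT hi N0).
rewrite (DE f)// (DE g)//; apply: le_Rintegral => //.
- exact: measurableD.
- by apply: (integrableS measurableT _ _ fi) => //; exact: measurableD.
- by apply: (integrableS measurableT _ _ gi) => //; exact: measurableD.
- by move=> x [_ /=]; exact: fg.
Qed.

Local Open Scope ereal_scope.

(** The integral of [g] may be +oo, so linearity for integrable functions does not apply. With h = g
    - k, the negative part of h is at most k and so has a finite integral; integrating h^+ + k = g +
    h^-, where all terms are nonnegative, and cancelling the finite terms gives the claim. *)
Lemma ge0_integralB_integrable (D : set T) (g : T -> \bar R) (k : T -> R) :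
  measurable D -> measurable_fun D g -> (forall x, D x -> 0 <= g x) ->
  mu.-integrable D (EFin \o k) -> (forall x, D x -> (0 <= k x)%R) ->
  \int[mu]_(x in D) (g x - (k x)%:E) =
  \int[mu]_(x in D) g x - \int[mu]_(x in D) (k x)%:E.
Proof.
move=> mD mg g0 ik k0.
have mk : measurable_fun D (EFin \o k) := measurable_int _ ik.
pose h x := g x - (k x)%:E.
have mh : measurable_fun D h by exact: emeasurable_funB.
have mp := measurable_funepos mh; have mn := measurable_funeneg mh.
have kfin : \int[mu]_(x in D) (k x)%:E \is a fin_num by exact: integrable_fin_num ik.
have neg_le : \int[mu]_(x in D) h^\- x <= \int[mu]_(x in D) (k x)%:E.
  apply: ge0_le_integral => // x Dx; rewrite funenegE /h ge_max lee_fin k0// andbT.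
  have := g0 x Dx; case: (g x) => [r| |] //=; last by rewrite leNye.
  by rewrite !lee_fin => r0; rewrite opprB gerBl.
have nfin : \int[mu]_(x in D) h^\- x \is a fin_num.
  rewrite ge0_fin_numE; last exact: integral_ge0.
  by apply: le_lt_trans neg_le _; rewrite ltey_eq kfin.
have E : \int[mu]_(x in D) h^\+ x + \int[mu]_(x in D) (k x)%:E =
         \int[mu]_(x in D) g x + \int[mu]_(x in D) h^\- x.
  rewrite -!ge0_integralD//; last first.
  apply: eq_integral => x /set_mem Dx.
  have := g0 x Dx; have := k0 x Dx; rewrite funeposE funenegE /h.
  case: (g x) => [r| |] //=; last by rewrite !maxye ?maxNye//.
  rewrite !lee_fin => kx rx; rewrite -!EFin_max -!EFinD; congr (_%:E).
  rewrite opprB; have [h1|h1] := leP 0%R (r - k x)%R.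
    by rewrite max_r; lra.
  by rewrite max_l; lra.
rewrite integralE -/(h) -[LHS]/(\int[mu]_(x in D) h^\+ x - \int[mu]_(x in D) h^\- x).
rewrite -[X in X - _ = _](addeK _ kfin) E.
by rewrite addeAC addeK.
Qed.

End integral_comparison.

Lemma limn_einf_le {R : realType} (a : nat -> \bar R) (b : nat -> R) (l : R) :
  (forall n, a n <= (b n)%:E)%E -> b n @[n --> \oo] --> l ->
  (limn_einf a <= l%:E)%E.
Proof.
move=> ab bl; rewrite limn_einf_lim.
have bl' : (b n)%:E @[n --> \oo] --> l%:E by apply: cvg_EFin => //; exact: nearW.
rewrite -(cvg_lim (@ereal_hausdorff R) bl'); apply: lee_lim.
- exact: is_cvg_einfs.
- by apply/cvg_ex; eexists; exact: bl'.
- by apply: nearW => n; apply: le_trans (ab n); apply: ereal_inf_lbound; exists n => /=.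
Qed.

(** * Image laws and independence *)

Section law.
Context {d d' : measure_display} {T : measurableType d} {T' : measurableType d'}
  {R : realType}.

Definition law (P : probability T R) (f : T -> T') (mf : measurable_fun setT f) :
    probability T' R :=
  let mixin := isMeasurableFun.Build _ _ _ _ f mf in
  let X : {RV P >-> T'} := HB.pack f mixin in
  distribution P X.

Lemma lawE (P : probability T R) (f : T -> T') (mf : measurable_fun setT f) A :
  law P mf A = P (f @^-1` A).
Proof. by []. Qed.

Lemma ge0_integral_law (P : probability T R) (f : T -> T')
    (mf : measurable_fun setT f) (h : T' -> \bar R) :
  measurable_fun setT h -> (forall x, 0 <= h x)%E ->
  (\int[law P mf]_x h x = \int[P]_w h (f w))%E.
Proof. by move=> mh h0; rewrite ge0_integral_pushforward//= preimage_setT. Qed.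

End law.

Section indep.
Context {d d1 d2 : measure_display} {T : measurableType d} {T1 : measurableType d1}
  {T2 : measurableType d2} {R : realType}.
Variables (P : probability T R) (mu : probability T2 R).
Variables (Z : T -> T1) (I : T -> T2).
Hypotheses (mZ : measurable_fun setT Z) (mI : measurable_fun setT I).
Hypothesis ind : forall A B, measurable A -> measurable B ->
  (P (Z @^-1` A `&` I @^-1` B) = P (Z @^-1` A) * mu B)%E.

(** On rectangles the law of (Z, I) agrees with the product of the law of [Z] and [mu], hence it is
    that product, and Tonelli applies. Leaving [mu] free allows an increment under [P x] to be
    integrated under [P 0]. *)
Lemma indep_integral (f : T1 * T2 -> \bar R) : measurable_fun setT f ->
  (forall x, 0 <= f x)%E ->
  (\int[P]_w f (Z w, I w) = \int[P]_w \int[mu]_i f (Z w, i))%E.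
Proof.
move=> mf f0.
have mZI : measurable_fun setT (fun w => (Z w, I w)) by exact/measurable_fun_pair.
have mF : measurable_fun setT (fun x => \int[mu]_i f (x, i))%E.
  exact: (measurable_fun_fubini_tonelli_F (m2 := mu) f).
rewrite -(ge0_integral_law P mZI mf)// -(ge0_integral_law P mZ mF)//; last first.
  by move=> x; exact: integral_ge0.
rewrite -[RHS](fubini_tonelli1 (m1 := law P mZ) (m2 := mu) f)//.
apply: eq_measure_integral => A mA _.
by apply/esym/product_measure_unique => // B C mB mC /=.
Qed.

End indep.

(** * Joint measurability of right-continuous processes *)

Section right_continuous.
Context {d : measure_display} {Omega : measurableType d} {R : realType}.

(** The process is the pointwise limit of its values at grid times [a n t] decreasing the gap to [t]
    from the right. Each approximant takes countably many times, so its preimages are countable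
    unions of rectangles. *)
Lemma measurable_right_continuous_process (Z : R -> Omega -> R) :
  (forall t, 0 <= t -> measurable_fun setT (Z t)) ->
  (forall w, right_continuous_path (Z ^~ w)) ->
  measurable_fun setT (fun p : measurableTypeR R * Omega => Z (Order.max 0 p.1) p.2).
Proof.
move=> mZ rcZ.
(* The grid point strictly after [t]: the successor matters because the limit along [t^'+] ignores
   the value at [t] itself. *)
pose a (n : nat) (t : R) : R := (Num.truncn (t * n.+1%:R)).+1%:R / n.+1%:R.
have an n t : 0 <= t -> t < a n t <= t + n.+1%:R^-1.
  move=> t0; rewrite /a ltr_pdivlMr ?ltr0n// ler_pdivrMr ?ltr0n//.
  have t1 : 0 <= t * n.+1%:R by rewrite mulr_ge0.
  have /andP[h1 h2] := truncn_itv t1.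
  rewrite h2 /= mulrDl mulVf ?pnatr_eq0// -[in X in X <= _]natr1.
  by rewrite lerD2r.
refine (measurable_fun_cvg (T := (measurableTypeR R * Omega)%type) (h := fun n p => Z (a n (Order.max 0 p.1)) p.2) _ _).
  move=> n; move=> mT B mB; rewrite setTI.
  pose D k : set R := (fun t : R => Order.max 0 t * n.+1%:R) @^-1` `[k%:R, k.+1%:R[.
  rewrite [X in measurable X](_ : _ =
     \bigcup_k (D k `*` (Z (k.+1%:R / n.+1%:R) @^-1` B))); last first.
    apply/seteqP; split => [[t w] /= H|[t w] /= [k _ [/=]]].
      exists (Num.truncn (Order.max 0 t * n.+1%:R)) => //; split => //=.
      rewrite /D/= in_itv/=; apply: truncn_itv.
      by rewrite mulr_ge0// le_max lexx.
    by rewrite /D/= in_itv/= => /truncn_def H; rewrite /a H.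
  apply: bigcup_measurable => k _; apply: measurableX.
    rewrite /D -[X in measurable X]setTI.
    apply: measurable_funM => //; apply: measurable_maxr => //.
  by rewrite -[X in measurable X]setTI; apply: mZ => //; rewrite divr_ge0.
move=> [t w] _ /=.
have m0 : 0 <= Order.max 0 t by rewrite le_max lexx.
move/cvg_at_rightP: (rcZ w _ m0); apply; split.
  by move=> n; have /andP[] := an n _ m0.
apply: (@squeeze_cvgr _ _ _ _ (fun=> Order.max 0 t) (fun n => Order.max 0 t + n.+1%:R^-1)).
- by near=> n; have /andP[/ltW -> ->] := an n _ m0.
- exact: cvg_cst.
- rewrite -[X in _ --> X]addr0; apply: cvgD; first exact: cvg_cst.
  exact: cvg_harmonic.
Unshelve. all: by end_near. Qed.

End right_continuous.

Section off_null_set.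
Context {d : measure_display} {Omega : measurableType d} {R : realType}.
Variables (N : set Omega) (mN : measurable N).

Definition vanish_on (Z : R -> Omega -> R) (t : R) (w : Omega) : R :=
  Z t w * \1_(~` N) w.

Lemma vanish_on_notin Z t w : ~ N w -> vanish_on Z t w = Z t w.
Proof. by move=> Nw; rewrite /vanish_on indicE mem_set// mulr1. Qed.

Lemma vanish_on_in Z t w : N w -> vanish_on Z t w = 0.
Proof. by move=> Nw; rewrite /vanish_on indicE memNset ?mulr0//=; exact. Qed.

Lemma measurable_vanish_on Z t : measurable_fun setT (Z t) ->
  measurable_fun setT (vanish_on Z t).
Proof. by move=> mZ; apply: measurable_funM => //; apply: measurable_indic; exact: measurableC. Qed.

Lemma vanish_on_right_continuous Z :
  (forall w, ~ N w -> right_continuous_path (Z ^~ w)) ->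
  forall w, right_continuous_path (vanish_on Z ^~ w).
Proof.
move=> rcZ w t t0; have [Nw|Nw] := pselect (N w).
  under eq_fun do rewrite vanish_on_in//.
  by rewrite vanish_on_in//; exact: cvg_cst.
under eq_fun do rewrite vanish_on_notin//.
by rewrite vanish_on_notin//; exact: rcZ.
Qed.

End off_null_set.

(** * The exponential law as discount *)

Section exp_law.
Context {R : realType}.
Variables (e : R) (e0 : 0 < e).
Local Notation leb := (@lebesgue_measure R).

(** The long name is the generated instance that makes the exponential measure of rate [e] a
    probability. *)
Definition exp_law : probability (measurableTypeR R) R :=
  exponential_distribution_exponential_prob__canonical__probability_measure_Probability e0.

(** The Radon-Nikodym derivative of the law with respect to Lebesgue measure and [exponential_pdf]
    have equal integrals over every measurable set, so they agree almost everywhere. *)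
Lemma ge0_integral_exp_law_pdf (f : R -> \bar R) : measurable_fun setT f ->
  (forall x, 0 <= f x)%E ->
  (\int[exp_law]_s f s = \int[leb]_s (f s * (exponential_pdf e s)%:E))%E.
Proof.
move=> mf f0.
have mpdf : measurable_fun setT (EFin \o exponential_pdf e).
  by apply/measurable_EFinP; exact: measurable_exponential_pdf.
have numu : exp_law `<< leb.
  apply/null_content_dominatesP => A mA A0.
  by rewrite /exp_law /= /exponential_prob null_set_integral//; exact: measurable_funTS.
rewrite -(Radon_Nikodym_SigmaFinite.change_of_variables numu)//.
have mrn := Radon_Nikodym_SigmaFinite.f_integrable numu.
apply: ge0_ae_eq_integral => //.
- exact: emeasurable_funM mf (measurable_int _ mrn).
- exact: emeasurable_funM mf mpdf.
- by move=> x _; rewrite mule_ge0// Radon_Nikodym_SigmaFinite.f_ge0.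
- by move=> x _; rewrite mule_ge0// lee_fin exponential_pdf_ge0// ltW.
apply: ae_eqe_mul2l; apply: integral_ae_eq => // E _ mE.
by rewrite -Radon_Nikodym_SigmaFinite.f_integral.
Qed.

Lemma ge0_integral_exp_law (f : R -> \bar R) : measurable_fun setT f ->
  (forall x, 0 <= f x)%E ->
  (\int[exp_law]_s f s =
   \int[leb]_(s in `[0%R, +oo[) (f s * (e * expR (- e * s))%:E))%E.
Proof.
move=> mf f0; rewrite (ge0_integral_exp_law_pdf mf f0) [RHS]integral_mkcond.
apply: eq_integral => x _; rewrite /exponential_pdf !patchE; case: ifPn => //.
by rewrite mule0.
Qed.

Lemma ge0_integral_shift (h : R) (f : R -> \bar R) : measurable_fun setT f ->
  (forall x, 0 <= f x)%E ->
  (\int[leb]_s f (s + h)%R = \int[leb]_s f s)%E.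
Proof.
move=> mf f0.
have msh : measurable_fun setT ((fun t : R => t + h) : measurableTypeR R -> measurableTypeR R).
  by apply: measurable_funD.
rewrite -(@ge0_integral_pushforward _ _ _ _ _ _ msh leb setT f)//.
apply: eq_measure_integral => A mA _.
apply/esym/lebesgue_measure_unique => //= _ [[a b]] _ <-.
rewrite [RHS](_ : _ = leb `]a - h, b - h]%classic).
  rewrite !lebesgue_measure_itv/= !lte_fin ltrD2r; case: ifP => // _.
  by rewrite -!EFinB; congr (_%:E); ring.
by congr (leb _); apply/seteqP; split => x /=; rewrite !in_itv/= ltrBlDr lerBrDr.
Qed.

Lemma ge0_integral_exp_law_shift (h : R) (f : R -> \bar R) :
  measurable_fun setT f -> (forall x, 0 <= f x)%E ->
  (\int[exp_law]_s f (s + h)%R =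
   \int[leb]_s (f s * (exponential_pdf e (s - h)%R)%:E))%E.
Proof.
move=> mf f0.
have mfh : measurable_fun setT (fun s : R => f (s + h)).
  by apply: (measurableT_comp mf); exact: measurable_funD.
have fh0 (s : R) : (0 <= f (s + h)%R)%E by exact: f0.
rewrite (ge0_integral_exp_law_pdf mfh fh0).
rewrite -[RHS](ge0_integral_shift h).
- by apply: eq_integral => s _; rewrite addrK.
- apply: emeasurable_funM => //; apply/measurable_EFinP.
  apply: (measurableT_comp (measurable_exponential_pdf e)).
  exact: measurable_funB.
- by move=> x; rewrite mule_ge0// lee_fin exponential_pdf_ge0// ltW.
Qed.

(** After a translation the density becomes that at [s - h], which is e^{eh} times the density at
    [s] for s >= h and zero for s < h. The right-hand side thus has the additional mass of [f]
    before [h], where [f] is nonnegative. *)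
Lemma exp_law_shift_le (h : R) (f : R -> R) : 0 <= h ->
  exp_law.-integrable setT (EFin \o f) -> (forall s, s < h -> 0 <= f s) ->
  exp_law.-integrable setT (fun s => (f (s + h))%:E) /\
  \int[exp_law]_s f (s + h) <= expR (e * h) * \int[exp_law]_s f s.
Proof.
move=> h0 fi fh.
have mpdf : measurable_fun setT (EFin \o exponential_pdf e).
  by apply/measurable_EFinP; exact: measurable_exponential_pdf.
have le_pdf s : exponential_pdf e (s - h) <= expR (e * h) * exponential_pdf e s.
  have [sh|sh] := leP h s.
    have s0 : 0 <= s by exact: le_trans sh.
    rewrite !exponential_pdfE ?subr_ge0// mulrCA -expRD ler_pM2l// ler_expR.
    by rewrite le_eqVlt; apply/orP; left; apply/eqP; ring.
  rewrite lt0_exponential_pdf ?subr_lt0//.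
  by rewrite mulr_ge0 ?expR_ge0// exponential_pdf_ge0// ltW.
have eq_pdf s : h <= s -> exponential_pdf e (s - h) = expR (e * h) * exponential_pdf e s.
  move=> sh; have s0 : 0 <= s by exact: le_trans sh.
  rewrite !exponential_pdfE ?subr_ge0// mulrCA -expRD; congr (_ * expR _); ring.
have le_int (g : R -> \bar R) : measurable_fun setT g -> (forall x, 0 <= g x)%E ->
    (\int[exp_law]_s g (s + h)%R <= (expR (e * h))%:E * \int[exp_law]_s g s)%E.
  move=> mg g0; rewrite (ge0_integral_exp_law_shift h mg g0) (ge0_integral_exp_law_pdf mg g0).
  rewrite -ge0_integralZl//.
  - apply: le_integral_pointwise => s; rewrite muleCA lee_pmul//.
      by rewrite lee_fin exponential_pdf_ge0// ltW.
    by rewrite -EFinM lee_fin.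
  - exact: emeasurable_funM mg mpdf.
  - by move=> x _; rewrite mule_ge0// lee_fin exponential_pdf_ge0// ltW.
have mf : measurable_fun setT (EFin \o f) := measurable_int _ fi.
have mfh : measurable_fun setT (fun s : R => (f (s + h))%:E).
  by apply: (measurableT_comp mf); exact: measurable_funD.
have ifh : exp_law.-integrable setT (fun s => (f (s + h))%:E).
  apply/integrableP; split => //.
  apply: le_lt_trans (le_int (abse \o (EFin \o f)) _ _) _.
  - exact: measurableT_comp.
  - by move=> x; exact: abse_ge0.
  rewrite lte_mul_pinfty ?lee_fin ?expR_ge0//.
  by case/integrableP: fi.
split => //.
rewrite /Rintegral -[expR (e * h)]/(fine (expR (e * h))%:E) -fineM//; last first.
  exact: integrable_fin_num.
apply: fine_le.
- exact: integrable_fin_num.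
- by rewrite fin_numM//; exact: integrable_fin_num.
rewrite integralE [X in (_ <= _ * X)%E]integralE muleBr//; last first.
  rewrite fin_num_adde_defr//; apply: integrable_fin_num => //.
  exact: integrable_funepos.
apply: leeB.
- under eq_integral do rewrite (funepos_comp (EFin \o f) (fun s => s + h)).
  by apply: (le_int (EFin \o f)^\+%E) => //; exact: measurable_funepos.
(* The negative part needs the reverse inequality: it vanishes before [h], and from [h] on the two
   densities differ exactly by the factor e^{eh}. *)
- have mfn : measurable_fun setT (EFin \o f)^\-%E by exact: measurable_funeneg.
  under [leRHS]eq_integral do rewrite (funeneg_comp (EFin \o f) (fun s => s + h)).
  rewrite (ge0_integral_exp_law_shift h mfn)//.
  have fn0 := funeneg_ge0 (EFin \o f).
  rewrite (ge0_integral_exp_law_pdf mfn fn0) -ge0_integralZl//.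
  + apply: le_integral_pointwise => s; rewrite muleCA.
    have [sh|sh] := leP h s; first by rewrite -EFinM eq_pdf.
    rewrite [(EFin \o f)^\-%E s](_ : _ = 0%E) ?mul0e// funenegE.
    by apply/max_idPr; rewrite /= lee_fin oppr_le0 fh.
  + exact: emeasurable_funM mfn mpdf.
  + by move=> x _; rewrite mule_ge0// lee_fin exponential_pdf_ge0// ltW.

Qed.

End exp_law.

(** * Stieltjes integrals of the discount factor *)

Section stieltjes.
Context {R : realType}.
Variables (e : R) (e0 : 0 < e).

Lemma exp_law_itvcy (s : R) : 0 <= s ->
  exp_law e0 `[s, +oo[%classic = (expR (- e * s))%:E.
Proof.
move=> s0.
pose f (t : R) : \bar R := (\1_(`[s, +oo[%classic : set R) t)%:E.
have mf : measurable_fun setT f by exact/measurable_EFinP.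
have f0 t : (0 <= f t)%E by rewrite lee_fin.
have mpdf : measurable_fun setT (EFin \o exponential_pdf e).
  by apply/measurable_EFinP; exact: measurable_exponential_pdf.
rewrite -[X in exp_law e0 X]setIT -integral_indic//.
rewrite (ge0_integral_exp_law_pdf e0 mf)//.
rewrite -(ge0_integral_shift s); last 2 first.
- exact: emeasurable_funM mf mpdf.
- by move=> x; rewrite mule_ge0// lee_fin exponential_pdf_ge0// ltW.
transitivity (\int[@lebesgue_measure R]_t ((expR (- e * s))%:E * (exponential_pdf e t)%:E))%E.
  apply: eq_integral => t _; rewrite /f indicE.
  have [t0|t0] := leP 0 t.
    rewrite mem_set/= ?in_itv/= ?andbT ?lerDr// mul1e.
    rewrite !exponential_pdfE ?addr_ge0// -EFinM; congr (_%:E).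
    by rewrite mulrDr expRD; ring.
  rewrite memNset/= ?in_itv/= ?andbT; last by apply/negP; rewrite -ltNge gtrDr.
  by rewrite mul0e lt0_exponential_pdf// mule0.
rewrite ge0_integralZl//; last first.
- by move=> x _; rewrite lee_fin exponential_pdf_ge0// ltW.
by rewrite integral_exponential_pdf// mule1.
Qed.

(** An integration by parts valid also when both sides are infinite: e^{-es} is the mass that the
    exponential law gives to [s, oo[, so Tonelli on the set of (s, t) with 0 < s <= t exchanges it
    with the mass g t - g 0 of ]0, t]. *)
Lemma stieltjes_integral_expR (g : R -> R) :
  nondecreasing_path g -> right_continuous_path g ->
  stieltjes_integral g (fun s => expR (- e * s)) =
  (\int[exp_law e0]_s (g (Order.max 0 s) - g 0)%:E)%E.
Proof.
move=> ndg rcg; rewrite /stieltjes_integral; case: pselect => [H|]; last by case.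
pose F : cumulative R R :=
  Defs_path_extension__canonical__lebesgue_stieltjes_measure_Cumulative H.1 H.2.
rewrite -[dpath _ _]/(lebesgue_stieltjes_measure_lebesgue_stieltjes_measure__canonical__measure_function_Measure F).
(* The same measure in its sigma-finite form, which Tonelli requires. *)
pose m1 : {sigma_finite_measure set (measurableTypeR R) -> \bar R} := lebesgue_stieltjes_measure F.
pose A := [set p : measurableTypeR R * measurableTypeR R | 0 < p.1 /\ p.1 <= p.2].
have mA : measurable A.
  have -> : A = (fst @^-1` `]0, +oo[%classic) `&` ((fun p => p.2 - p.1) @^-1` `[0, +oo[%classic).
    by apply/seteqP; split => p /=; rewrite !in_itv/= !andbT subr_ge0.
  apply: measurableI; rewrite -[X in measurable X]setTI.
    exact: measurable_fst.
  by apply: measurable_funB.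
pose f p := (\1_A p)%:E : \bar R.
have mf : measurable_fun setT f by apply/measurable_EFinP.
have f0 p : (0 <= f p)%E by rewrite lee_fin.
have := fubini_tonelli (m1 := m1) (m2 := exp_law e0) f mf f0.
rewrite [X in X = _ -> _](_ : _ = \int[m1]_(s in `]0%R, +oo[) (expR (- e * s))%:E)%E; last first.
  rewrite [RHS]integral_mkcond; apply: eq_integral => s _.
  rewrite patchE; case: ifPn.
    rewrite inE/= in_itv/= andbT => s0; rewrite -(exp_law_itvcy (ltW s0)).
    rewrite -[RHS]mul1e -integral_cst// [RHS]integral_mkcond; apply: eq_integral => t _.
    rewrite patchE; case: ifPn; rewrite /f indicE.
      by rewrite inE/= in_itv/= andbT => st; rewrite mem_set.
    rewrite notin_setE/= in_itv/= andbT => st.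
    by rewrite memNset//= => -[_ sT]; apply: st.
  rewrite notin_setE/= in_itv/= andbT => s0; apply: (integral0_eq (exp_law e0)) => t _.
  by rewrite /f indicE memNset// => -[].
move=> ->; apply: eq_integral => t _.
rewrite [LHS](_ : _ = m1 `]0%R, Order.max 0 t]%classic); last first.
  rewrite -[RHS]mul1e -integral_cst// [RHS]integral_mkcond; apply: eq_integral => s _.
  rewrite patchE; case: ifPn; rewrite /f indicE.
    rewrite inE/= in_itv/= le_max => /andP[s0 /orP[|st]]; first by rewrite leNgt s0.
    by rewrite mem_set.
  rewrite notin_setE/= in_itv/= le_max => st; rewrite memNset//=.
  by move=> [s0 sT]; apply: st; rewrite s0 sT orbT.
rewrite /m1/= /lebesgue_stieltjes_measure /measure_extension measurable_mu_extE/=; last exact: is_ocitv.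
by rewrite wlength_itv_bnd ?le_max ?lexx//= /path_extension maxxx maxA maxxx.
Qed.

End stieltjes.

Section exp_law_integrals.
Context {R : realType}.
Variables (e : R) (e0 : 0 < e).

(** Half of the exponent absorbs the factor 1 + s. Since 1 + s <= (1 + 2/e)(1 + es/2) and (1 + es/2)
    e^{-es/2} <= 1, the integrand times the density of rate e is at most 2(1 + 2/e) times the
    density of rate e/2. *)
Lemma integral_exp_law_affine :
  (\int[exp_law e0]_s (1 + Order.max 0 s)%:E < +oo)%E.
Proof.
have e20 : 0 < e / 2 by rewrite divr_gt0.
have mm : measurable_fun setT (fun s : R => (1 + Order.max 0 s)%:E).
  by apply/measurable_EFinP; apply: measurable_funD => //; exact: measurable_maxr.
have m0 (s : R) : (0 <= (1 + Order.max 0 s)%:E)%E.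
  by rewrite lee_fin addr_ge0// le_max lexx.
have K0 : 0 <= 1 + 2 / e by rewrite addr_ge0// divr_ge0// ltW.
apply: (@le_lt_trans _ _ (\int[exp_law e20]_s (cst (2 * (1 + 2 / e))%:E s))%E).
  have mcst : measurable_fun setT (cst (2 * (1 + 2 / e))%:E : R -> \bar R) by exact: measurable_cst.
  have cst_ge0 (s : R) : (0 <= cst (2 * (1 + 2 / e))%:E s)%E by rewrite lee_fin mulr_ge0.
  rewrite (ge0_integral_exp_law e0 mm m0) (ge0_integral_exp_law e20 mcst cst_ge0).
  apply: ge0_le_integral => //.
  - by move=> s _; rewrite mule_ge0// lee_fin mulr_ge0 ?expR_ge0// ltW.
  - apply: measurable_funTS; apply/measurable_EFinP.
    apply: measurable_funM; first by apply: measurable_funD => //; exact: measurable_maxr.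
    by apply: measurable_funM => //; apply: measurableT_comp => //; exact: measurable_funM.
  - apply: measurable_funTS; apply/measurable_EFinP; apply: measurable_funM => //.
    by apply: measurable_funM => //; apply: measurableT_comp => //; exact: measurable_funM.
  move=> s /=; rewrite in_itv/= andbT => s0.
  rewrite max_r// -!EFinM lee_fin.
  rewrite (_ : - e * s = - (e / 2) * s + - (e / 2) * s); last by field.
  rewrite expRD; set E := expR _.
  have E0 : 0 < E by exact: expR_gt0.
  have : 1 + e / 2 * s <= E^-1 by rewrite /E -expRN mulNr opprK expR_ge1Dx.
  rewrite -[E^-1]mul1r ler_pdivlMr// => H.
  have K : (1 + s) <= (1 + 2 / e) * (1 + e / 2 * s).
    rewrite -subr_ge0 (_ : _ - _ = 2 / e + e / 2 * s); last by field; rewrite gt_eqF.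
    by rewrite addr_ge0 ?mulr_ge0 ?invr_ge0 ?(ltW e0).
  rewrite (_ : (1 + s) * _ = (1 + s) * E * (e * E)); last by ring.
  rewrite (_ : 2 * _ * _ = (1 + 2 / e) * (e * E)); last by field; rewrite gt_eqF.
  rewrite ler_wpM2r ?mulr_ge0 ?(ltW E0) ?(ltW e0)//.
  apply: le_trans (ler_wpM2r (ltW E0) K) _.
  by rewrite -[leLHS]mulrA ler_piMr.
rewrite integral_cst//.
by rewrite [X in (_ * X)%E](@probability_setT _ _ _ (exp_law e20)) mule1 ltry.
Qed.

Lemma exp_law_lt0 : exp_law e0 `]-oo, 0[%classic = 0.
Proof.
have -> : `]-oo, 0[%classic = ~` (`[0, +oo[%classic : set R).
  by rewrite setCitvr.
rewrite probability_setC// exp_law_itvcy// mulr0 expR0.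
by rewrite subee.
Qed.

Lemma exp_law_le_Rintegral (f g : R -> R) :
  (exp_law e0).-integrable setT (EFin \o f) ->
  (exp_law e0).-integrable setT (EFin \o g) ->
  (forall s, 0 <= s -> f s <= g s) ->
  \int[exp_law e0]_s f s <= \int[exp_law e0]_s g s.
Proof.
move=> fi gi fg; apply: (ae_le_Rintegral _ exp_law_lt0 fi gi).
  exact: measurable_itv.
by move=> s /=; rewrite in_itv/= => /negP; rewrite -leNgt; exact: fg.
Qed.

(** The derivative of exp at 0 along h = 1/(n+1): the factor e^{eh} - 1 left over by a time shift,
    divided by h, becomes [e]. *)
Lemma cvg_expR_quotient :
  n.+1%:R * (expR (e * n.+1%:R^-1) - 1) @[n --> \oo] --> e.
Proof.
have [dexp] := @is_derive_expR R 0; rewrite expR0 => E.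
have : h^-1 *: ((expR \o shift 0) (h *: 1) - expR 0) @[h --> 0^'] --> (1 : R).
  by rewrite -[X in _ --> X]E; exact: dexp.
move=> /cvg_dnbhs_at_right /cvg_at_rightP /(_ (fun n => e * n.+1%:R^-1)) H.
have {}H := H _.
rewrite -[X in _ --> X]mulr1.
rewrite [X in X @ _ --> _](_ : _ = (fun n => e * ((e * n.+1%:R^-1)^-1 * (expR (e * n.+1%:R^-1) - 1)))).
  apply: cvgM; first exact: cvg_cst.
  have : (fun n : nat => e * n.+1%:R^-1) @ \oo --> 0.
    by rewrite -[X in _ --> X](mulr0 e); apply: cvgM; [exact: cvg_cst|exact: cvg_harmonic].
  move=> c0; apply: cvg_trans (H _); last first.
    by split => // n; rewrite mulr_gt0// invr_gt0.
  apply: near_eq_cvg; apply: nearW => n.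
  by rewrite /= /shift/= addr0 expR0 /GRing.scale/= mulr1.
apply/funext => n; rewrite mulrA; congr (_ * _).
by rewrite invfM invrK mulrA mulfV ?gt_eqF// mul1r.
Qed.

End exp_law_integrals.

Section weight.
Context {R : realType}.
Variables (e : R) (e0 : 0 < e).

Lemma ge0_integral_expR_weight (phi : R -> R) : measurable_fun setT phi ->
  (forall s, 0 <= phi s) ->
  (\int[@lebesgue_measure R]_(s in `]0%R, +oo[) (expR (- e * s) * phi s)%:E =
   (e^-1)%:E * \int[exp_law e0]_s (phi s)%:E)%E.
Proof.
move=> mphi phi0.
have mp : measurable_fun setT (EFin \o phi) by exact/measurable_EFinP.
have mx : measurable_fun setT (fun s : R => expR (- e * s)).
  by apply: measurableT_comp => //; exact: measurable_funM.
rewrite (ge0_integral_exp_law e0 mp)//.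
rewrite -integral_itv_obnd_cbnd; last first.
  apply: measurable_funTS; apply: emeasurable_funM => //.
  by apply/measurable_EFinP; exact: measurable_funM.
rewrite -ge0_integralZl//.
- apply: eq_integral => s _; rewrite /= -!EFinM; congr (_%:E); field.
  by rewrite gt_eqF.
- apply: measurable_funTS; apply: emeasurable_funM => //.
  by apply/measurable_EFinP; exact: measurable_funM.
- by move=> s _; rewrite lee_fin !mulr_ge0 ?expR_ge0// ltW.
- by rewrite lee_fin invr_ge0 ltW.
Qed.

End weight.

(** * Increments of a Lévy process with finite mean *)

Section subadditive.
Context {R : realType}.
Variable b : R -> R.
Hypotheses (mb : measurable_fun setT b)
  (b_diff : forall s t : R, 0 <= s -> 0 <= t -> b s <= b t + b (t + s))
  (b_add : forall s t : R, 0 <= s -> 0 <= t -> b (t + s) <= b t + b s).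
Local Notation leb := (@lebesgue_measure R).

(* A set of measure more than 3/2 in [0, 2] meets all its translates by s in
   [0, 1], so that s = (t + s) - t with b bounded at both t and t + s. *)
Lemma locally_bounded_of_measurable :
  exists2 C, 0 <= C & forall s : R, 0 <= s <= 1 -> b s <= C.
Proof.
pose A (n : nat) : set R := [set t : R | 0 <= t <= 2 /\ b t <= n%:R].
have mA n : measurable (A n).
  rewrite (_ : A n = `[0, 2]%classic `&` (b @^-1` `]-oo, n%:R]%classic)); last first.
    by apply/seteqP; split => t /=; rewrite !in_itv/=.
  by apply: measurableI => //; rewrite -[X in measurable X]setTI; exact: mb.
have ndA : nondecreasing_seq A.
  move=> m n mn; apply/subsetPset => t [t2 bt].
  by split => //; rewrite (le_trans bt)// ler_nat.
have UA : \bigcup_n A n = `[0, 2]%classic.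
  apply/seteqP; split => [t [n _ []]|t] /=; rewrite in_itv//= => t2.
  exists (Num.truncn `|b t|).+1 => //; split => //=.
  apply: le_trans (ler_norm _) _.
  by have /andP[_ /ltW] := truncn_itv (normr_ge0 (b t)).
have [n An] : exists n, ((3 / 2)%:E < leb (A n))%E.
  apply: contrapT => noA.
  have mUA : measurable (\bigcup_n A n) by rewrite UA.
  have cA := @nondecreasing_cvg_mu _ _ _ leb _ mA mUA ndA.
  have : (limn (leb \o A) <= (3 / 2)%:E)%E.
    apply: lime_le; first by apply/cvg_ex; eexists; exact: cA.
    by apply: nearW => n; rewrite leNgt; apply/negP => An; apply: noA; exists n.
  rewrite [limn _](cvg_lim (@ereal_hausdorff R) cA) UA.
  rewrite /= lebesgue_measure_itv/= lte_fin ifT//.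
  by rewrite -EFinB lee_fin; lra.
exists (n%:R + n%:R) => [|s /andP[s0 s1]]; first by rewrite addr_ge0.
suff [t [At Ats]] : exists t, A n t /\ A n (t + s).
  case: At => /andP[t0 _] bt; case: Ats => _ bts.
  by apply: le_trans (b_diff s0 t0) _; exact: lerD.
pose B : set R := [set t | A n (t + s)].
have mB : measurable B.
  by rewrite -[X in measurable X]setTI; apply: (measurable_funD (f := id) (g := cst s)).
have BA : leb B = leb (A n).
  have mi : measurable_fun setT (EFin \o \1_(A n) : R -> \bar R) by exact/measurable_EFinP.
  have := ge0_integral_shift s mi; rewrite -[X in leb X]setIT -[X in _ = leb X]setIT.
  rewrite -(integral_indic leb measurableT mB) -(integral_indic leb measurableT (mA n)) => <- //.
  by move=> x; rewrite lee_fin.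
apply: contrapT => noT.
(* [A n] lies in [0, 2] and [B], its translate by -s, in [-1, 2]. If disjoint, two sets of measure
   above 3/2 would have to fit in length 3; this fixes the constant 3/2. *)
pose I : set R := `[-1, 2]%classic.
have sub (t : R) : A n t \/ B t -> I t.
  rewrite /A /B /I /= !in_itv/=.
  by move=> [[/andP[t0 t2] _]|[/andP[t0 t2] _]]; apply/andP; split; lra.
have : (leb (A n `|` B) <= leb I)%E.
  apply: le_measure; [rewrite inE; exact: measurableU (mA n) mB|
    rewrite inE; exact: measurable_itv|exact: sub].
rewrite measureU//; [|exact: mA|]; last first.
  by rewrite -subset0 => t [At Bt]; apply: noT; exists t.
have -> : leb I = 3%:E.
  by rewrite lebesgue_measure_itv/= lte_fin ifT ?EFinN ?oppeK -?EFinD; [congr (_%:E)|]; lra.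
rewrite -[X in (_ + X)%E]/(leb B) -[X in (X + _)%E]/(leb (A n)) BA.
rewrite leNgt => /negP; apply.
rewrite [ltLHS](_ : _ = (3/2)%:E + (3/2)%:E)%E; last by rewrite -!EFinD; congr (_%:E); field.
exact: lteD.
Qed.

(** Write s as its integer part plus a remainder in [0, 1]; by subadditivity every unit step adds at
    most the local bound [C]. It is used for b s = E|X_s - X_0|. *)
Lemma linear_growth_of_measurable :
  exists2 C, 0 <= C & forall s : R, 0 <= s -> b s <= C * (1 + s).
Proof.
have [C C0 bC] := locally_bounded_of_measurable.
exists C => // s s0.
pose k := Num.truncn s.
have /andP[ks sk] : k%:R <= s < k.+1%:R by exact: truncn_itv.
have step n (r : R) : 0 <= r <= 1 -> b (r + n%:R) <= C * (1 + n%:R).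
  move=> /andP[r0 r1]; elim: n => [|n IH]; first by rewrite !addr0 mulr1 bC// r0.
  rewrite -natr1 addrA; apply: le_trans (b_add _ _) _ => //.
    by rewrite addr_ge0.
  by rewrite addrA mulrDr mulr1 lerD// bC// lexx ler01.
rewrite -(subrK k%:R s); apply: le_trans (step _ _ _) _.
  by rewrite subr_ge0 ks lerBlDl natr1 ltW.
by rewrite ler_wpM2l// lerD2l subrK.
Qed.

End subadditive.

Section levy.
Context {d : measure_display} {Omega : measurableType d} {R : realType}.
Variables (P : R -> probability Omega R) (F : R -> set (set Omega))
  (X : R -> Omega -> R).

Lemma adapted_measurable (Y : R -> Omega -> R) t : filtration P F ->
  adapted F Y -> 0 <= t -> measurable_fun setT (Y t).
Proof.
move=> hF aY t0 _ B mB; rewrite setTI.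
exact: (filtration_sub hF t0 (aY t t0 B mB)).
Qed.

Hypotheses (hF : filtration P F) (hX : levy_process P F X) (hmean : finite_mean P X).

Lemma measurable_levy t : 0 <= t -> measurable_fun setT (X t).
Proof. exact: adapted_measurable hF (levy_adapted hX). Qed.

Lemma measurable_increment s t : 0 <= s -> 0 <= t ->
  measurable_fun setT (increment X s t).
Proof. by move=> s0 t0; apply: measurable_funB; exact: measurable_levy. Qed.

Lemma ge0_integral_increment x s h (f : R -> \bar R) : 0 <= s -> 0 <= h ->
  measurable_fun setT f -> (forall y, 0 <= f y)%E ->
  (\int[P x]_w f (increment X s (s + h) w) =
   \int[P 0]_w f (increment X 0 h w))%E.
Proof.
move=> s0 h0 mf f0.
have m1 := measurable_increment s0 (addr_ge0 s0 h0).
have m2 := measurable_increment (lexx 0) h0.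
rewrite -(ge0_integral_law (P x) m1 mf)// -(ge0_integral_law (P 0) m2 mf)//.
have st B : measurable B -> law (P x) m1 B = law (P 0) m2 B.
  move=> mB; have := levy_stationary hX x 0 s0 (_ : s <= s + h) mB.
  rewrite addrAC subrr add0r lerDl => /(_ h0) H.
  by rewrite (lawE (P x) m1 B) (lawE (P 0) m2 B).
by apply: eq_measure_integral => B mB _; exact: st.
Qed.

Lemma integral_increment x s h (f : R -> \bar R) : 0 <= s -> 0 <= h ->
  measurable_fun setT f ->
  (\int[P x]_w f (increment X s (s + h) w) =
   \int[P 0]_w f (increment X 0 h w))%E.
Proof.
move=> s0 h0 mf.
have posneg (Q : probability Omega R) (Y : Omega -> R) : (\int[Q]_w f (Y w) =
    \int[Q]_w f^\+ (Y w) - \int[Q]_w f^\- (Y w))%E.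
  rewrite integralE; congr (_ - _)%E; apply: eq_integral => w _.
    by rewrite !funeposE.
  by rewrite !funenegE.
rewrite !posneg; congr (_ - _)%E.
- exact: (ge0_integral_increment x s0 h0 (measurable_funepos mf) (funepos_ge0 f)).
- exact: (ge0_integral_increment x s0 h0 (measurable_funeneg mf) (funeneg_ge0 f)).
Qed.

(** [Z] is measurable for [F s], hence independent of the increment after [s], whose law under [P x]
    is by stationarity that of the increment from 0 to [h] under [P 0]. The increment can therefore
    be integrated with [Z] frozen. *)
Lemma levy_markov x s h (Z : Omega -> R) (f : R * R -> \bar R) :
  0 <= s -> 0 <= h -> (forall B, measurable B -> F s (Z @^-1` B)) ->
  measurable_fun setT f -> (forall p, 0 <= f p)%E ->
  (\int[P x]_w f (Z w, increment X s (s + h) w) =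
   \int[P x]_w \int[P 0]_v f (Z w, increment X 0 h v))%E.
Proof.
move=> s0 h0 FZ mf f0.
have m1 := measurable_increment s0 (addr_ge0 s0 h0).
have m2 := measurable_increment (lexx 0) h0.
have mZ : measurable_fun setT Z.
  by move=> _ B mB; rewrite setTI; exact: (filtration_sub hF s0 (FZ B mB)).
rewrite (indep_integral (mu := law (P 0) m2) mZ m1)//; last first.
  move=> A B mA mB; rewrite (lawE (P 0) m2 B).
  rewrite (levy_independent hX x s0 _ (FZ A mA) mB) ?lerDl//; congr (_ * _)%E.
  have := levy_stationary hX x 0 s0 (_ : s <= s + h) mB.
  by rewrite addrAC subrr add0r lerDl; exact.
apply: eq_integral => w _; rewrite (ge0_integral_law (P 0) m2)//.
exact: measurableT_comp.
Qed.

Lemma integrable_increment x s t : 0 <= s -> 0 <= t ->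
  (P x).-integrable setT (EFin \o increment X s t).
Proof.
by move=> s0 t0; apply: (@integrableB _ _ _ (P x) setT _ (EFin \o X t) (EFin \o X s)) => //;
  exact: hmean.
Qed.

Definition mean_increment (h : R) : R := \int[P 0]_w increment X 0 h w.
Definition abs_increment (h : R) : R := \int[P 0]_w `|increment X 0 h w|.

Lemma mean_incrementE x s h : 0 <= s -> 0 <= h ->
  \int[P x]_w increment X s (s + h) w = mean_increment h.
Proof.
move=> s0 h0; congr fine.
by apply: (integral_increment x s0 h0 (f := EFin)).
Qed.

Lemma abs_incrementE x s h : 0 <= s -> 0 <= h ->
  \int[P x]_w `|increment X s (s + h) w| = abs_increment h.
Proof.
move=> s0 h0; congr fine.
apply: (integral_increment x s0 h0 (f := fun y => `|y|%:E)).
exact/measurable_EFinP.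
Qed.

Lemma integrable_abs_increment x s t : 0 <= s -> 0 <= t ->
  (P x).-integrable setT (EFin \o (fun w => `|increment X s t w|)).
Proof. by move=> s0 t0; exact/integrable_norm/integrable_increment. Qed.

Lemma mean_increment_add s t : 0 <= s -> 0 <= t ->
  mean_increment (s + t) = mean_increment s + mean_increment t.
Proof.
move=> s0 t0; rewrite -(mean_incrementE 0 s0 t0) -RintegralD//.
- by apply: eq_Rintegral => w _; rewrite /increment; ring.
- exact: integrable_increment.
- by apply: integrable_increment => //; exact: addr_ge0.
Qed.

Lemma abs_increment_add s t : 0 <= s -> 0 <= t ->
  abs_increment (t + s) <= abs_increment t + abs_increment s.
Proof.
move=> s0 t0; rewrite -(abs_incrementE 0 t0 s0) -RintegralD//; last 2 first.
- exact: integrable_abs_increment.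
- by apply: integrable_abs_increment => //; exact: addr_ge0.
apply: le_Rintegral => //.
- by apply: integrable_abs_increment => //; exact: addr_ge0.
- by apply: (@integrableD _ _ _ (P 0) setT _ (fun w => (`|increment X 0 t w|)%:E)
     (fun w => (`|increment X t (t + s) w|)%:E)) => //;
  apply: integrable_abs_increment => //; exact: addr_ge0.
- move=> w _; rewrite (_ : increment X 0 _ w = increment X 0 t w + increment X t (t + s) w).
    exact: ler_normD.
  by rewrite /increment; ring.
Qed.

Lemma abs_increment_diff s t : 0 <= s -> 0 <= t ->
  abs_increment s <= abs_increment t + abs_increment (t + s).
Proof.
move=> s0 t0; rewrite -(abs_incrementE 0 t0 s0) -RintegralD//; last 2 first.
- exact: integrable_abs_increment.
- by apply: integrable_abs_increment => //; exact: addr_ge0.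
apply: le_Rintegral => //.
- by apply: integrable_abs_increment => //; exact: addr_ge0.
- by apply: (@integrableD _ _ _ (P 0) setT _ (fun w => (`|increment X 0 t w|)%:E)
     (fun w => (`|increment X 0 (t + s) w|)%:E)) => //;
  apply: integrable_abs_increment => //; exact: addr_ge0.
- move=> w _; rewrite (_ : increment X t _ w = increment X 0 (t + s) w - increment X 0 t w).
    by rewrite [leRHS]addrC; exact: ler_normB.
  by rewrite /increment; ring.
Qed.

Lemma mean_le_abs_increment h : 0 <= h -> `|mean_increment h| <= abs_increment h.
Proof. by move=> h0; apply: le_normr_Rintegral => //; exact: integrable_increment. Qed.

(** Tonelli gives measurability in time once the integrand is jointly measurable, which is where
    right-continuity of the paths enters. Zeroing the paths on a null set does not change the
    expectations. *)
Lemma measurable_abs_increment :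
  measurable_fun setT (fun s : R => abs_increment (Order.max 0 s)).
Proof.
have [N [mN PN XN]] := levy_cadlag hX 0.
have rcX w : ~ N w -> right_continuous_path (X ^~ w).
  by move=> Nw; apply: contrapT => H; apply: Nw; apply: XN => -[].
pose Z := vanish_on N X.
have mZ t : 0 <= t -> measurable_fun setT (Z t).
  by move=> t0; apply: measurable_vanish_on => //; exact: measurable_levy.
have jZ := measurable_right_continuous_process mZ (vanish_on_right_continuous rcX).
pose f (p : measurableTypeR R * Omega) : \bar R := (`|Z (Order.max 0 p.1) p.2 - Z 0 p.2|)%:E.
have mf : measurable_fun setT f.
  apply/measurable_EFinP; apply: measurableT_comp => //; apply: measurable_funB => //.
  exact: (measurableT_comp (mZ _ (lexx 0)) measurable_snd).
have f0 p : (0 <= f p)%E by rewrite lee_fin.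
have := measurableT_comp (fine_measurable measurableT)
  (measurable_fun_fubini_tonelli_F (m2 := P 0) f mf f0).
apply: eq_measurable_fun => s _ /=.
have s0 : 0 <= Order.max 0 s by rewrite le_max lexx.
congr fine; apply: ae_eq_integral => //.
- apply/measurable_EFinP; apply: measurableT_comp => //.
  exact: (measurable_funB (mZ _ s0) (mZ _ (lexx 0))).
- apply/measurable_EFinP; apply: measurableT_comp => //.
  exact: measurable_increment.
exists N; split => //= w /= H1; apply: contrapT => Nw; apply: H1 => _.
by rewrite /f/= /Z !vanish_on_notin.
Qed.

(** The first bound serves integrability over all times, the second the difference quotients at step
    1/(n+1). For the second, additivity gives (n+1) m(s) = m((n+1)s) for the mean m, and (n+1)s <=
    1, where the first bound is at most twice the growth constant; hence the witness [C * 2]. *)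
Lemma increment_bounds : exists2 C, 0 <= C &
  (forall s, 0 <= s -> abs_increment s <= C * (1 + s)) /\
  (forall s n, 0 <= s <= n.+1%:R^-1 -> `|mean_increment s| <= C / n.+1%:R).
Proof.
have [C C0 H] : exists2 C, 0 <= C &
    forall s : R, 0 <= s -> abs_increment (Order.max 0 s) <= C * (1 + s).
  apply: linear_growth_of_measurable; first exact: measurable_abs_increment.
  - by move=> s t s0 t0; rewrite !max_r ?addr_ge0//; exact: abs_increment_diff.
  - by move=> s t s0 t0; rewrite !max_r ?addr_ge0//; exact: abs_increment_add.
have H' s : 0 <= s -> abs_increment s <= C * (1 + s).
  by move=> s0; have := H s s0; rewrite max_r.
exists (C * 2); first by rewrite mulr_ge0.
split => [s s0|s n /andP[s0 sn]].
  by apply: le_trans (H' s s0) _; rewrite ler_wpM2r ?addr_ge0// ler_peMr// ler1n.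
have mul k : mean_increment (s *+ k.+1) = mean_increment s *+ k.+1.
  elim: k => [//|k IH]; rewrite mulrSr mean_increment_add// ?mulrn_wge0//.
  by rewrite IH -mulrSr.
rewrite ler_pdivlMr ?ltr0n// -[X in _ * X](@ger0_norm _ n.+1%:R)// -normrM (mulr_natr (mean_increment s)) -mul.
have sn0 : 0 <= s *+ n.+1 by rewrite mulrn_wge0.
apply: le_trans (mean_le_abs_increment sn0) _.
apply: le_trans (H' _ sn0) _; rewrite ler_wpM2l//.
have : s *+ n.+1 <= 1 by rewrite -mulr_natr -ler_pdivlMr ?ltr0n// mul1r.
lra.
Qed.

End levy.

(** * The semigroup difference of [u] and its generator *)

Section semigroup.
Context {d : measure_display} {Omega : measurableType d} {R : realType}.
Variables (P : R -> probability Omega R) (F : R -> set (set Omega))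
  (X : R -> Omega -> R).
Hypotheses (hF : filtration P F) (hX : levy_process P F X) (hmean : finite_mean P X).
Variables (u : R -> R) (qu qd : R).
Hypotheses (cu : convex_on_R u) (du : forall x, derivable u x 1)
  (qu0 : 0 < qu) (qd0 : 0 < qd) (hs : forall x, - qu <= derive1 u x <= qd).
Local Notation Q := (qu + qd).

Let Q0 : 0 <= Q. Proof. by rewrite addr_ge0// ltW. Qed.

Let lip y z : `|u z - u y| <= Q * `|z - y|.
Proof. exact: slope_lip. Qed.

Lemma measurable_derivable : measurable_fun setT u.
Proof.
apply: continuous_measurable_fun => x; apply: differentiable_continuous.
exact/derivable1_diffP.
Qed.
Let mu_ := measurable_derivable.

(** Keeping the difference under the integral makes the integrand at most [Q] times the absolute
    increment, so that the result is bounded uniformly in [y]. *)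
Definition semigroup_diff (h y : R) : R :=
  \int[P 0]_v (u (y + increment X 0 h v) - u y).

Lemma integrable_lipschitz_diff x (Y I : Omega -> R) : measurable_fun setT Y ->
  (P x).-integrable setT (EFin \o I) ->
  (P x).-integrable setT (fun w => (u (Y w + I w) - u (Y w))%:E).
Proof.
move=> mY iI.
have mI : measurable_fun setT I by apply/measurable_EFinP; exact: measurable_int iI.
have := integrableZl measurableT Q (integrable_norm iI).
apply: le_integrable => //.
- apply/measurable_EFinP; apply: measurable_funB; apply: measurableT_comp => //.
  exact: measurable_funD.
- move=> w _ /=; rewrite lee_fin (le_trans (lip _ _))//.
  by rewrite addrAC subrr add0r normrM normr_id ger0_norm.
Qed.

Lemma semigroup_diff_abs h y : 0 <= h ->
  `|semigroup_diff h y| <= Q * abs_increment P X h.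
Proof.
move=> h0.
have iI := integrable_increment hmean 0 (lexx 0) h0.
have idf := integrable_lipschitz_diff (Y := cst y) (measurable_cst _) iI.
apply: le_trans (le_normr_Rintegral _ idf) _ => //.
rewrite /abs_increment -RintegralZl//; last exact: integrable_norm iI.
apply: le_Rintegral => //; first exact: integrable_norm idf.
  exact: (integrableZl measurableT Q (integrable_norm iI)).
by move=> w _; rewrite (le_trans (lip _ _))// addrAC subrr add0r.
Qed.

Lemma semigroup_diff_ge h y : 0 <= h ->
  - (Q * `|mean_increment P X h|) <= semigroup_diff h y.
Proof.
move=> h0.
have iI := integrable_increment hmean 0 (lexx 0) h0.
have idf := integrable_lipschitz_diff (Y := cst y) (measurable_cst _) iI.
apply: (@le_trans _ _ (derive1 u y * mean_increment P X h)).
  rewrite lerNl (le_trans (ler_norm _))// normrN normrM ler_wpM2r//.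
  have /andP[s1 s2] := hs y; by rewrite ler_norml; have := qu0; have := qd0; lra.
rewrite /mean_increment -RintegralZl//; apply: le_Rintegral => //.
  exact: (integrableZl measurableT (derive1 u y) iI).
move=> w _; rewrite lerBrDl.
have := convex_tangent cu du y (y + increment X 0 h w).
by rewrite [X in _ * X]addrAC subrr add0r.
Qed.

(* The Lipschitz compensator [Q * `|i|] makes the integrand nonnegative. *)
Let comp (p : R * R) : \bar R := (u (p.1 + p.2) - u p.1 + Q * `|p.2|)%:E.

Let mcomp : measurable_fun setT comp.
Proof.
apply/measurable_EFinP; apply: measurable_funD; last first.
  by apply: measurable_funM => //; apply: measurableT_comp.
apply: measurable_funB; apply: measurableT_comp => //.
exact: measurable_funD.
Qed.

Let comp_ge0 p : (0 <= comp p)%E.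
Proof.
rewrite lee_fin /=; have := lip p.1 (p.1 + p.2).
by rewrite [X in Q * `|X|]addrAC subrr add0r ler_norml => /andP[]; lra.
Qed.

Let comp_int h y : 0 <= h ->
  (\int[P 0]_v comp (y, increment X 0 h v))%E =
  (semigroup_diff h y + Q * abs_increment P X h)%:E.
Proof.
move=> h0.
have iI := integrable_increment hmean 0 (lexx 0) h0.
have idf := integrable_lipschitz_diff (Y := cst y) (measurable_cst _) iI.
have iQ := integrableZl measurableT Q (integrable_norm iI).
rewrite /abs_increment -RintegralZl//; last exact: integrable_norm iI.
rewrite /semigroup_diff -RintegralD// /Rintegral fineK//.
apply: integrable_fin_num => //.
exact: (integrableD measurableT idf iQ).
Qed.

Lemma measurable_semigroup_diff h : 0 <= h -> measurable_fun setT (semigroup_diff h).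
Proof.
move=> h0.
have mI := measurable_increment hF hX (lexx 0) h0.
have mf : measurable_fun setT (fun p : R * Omega => comp (p.1, increment X 0 h p.2)).
  apply: (measurableT_comp mcomp); apply: measurable_fun_pair => //.
  exact: measurableT_comp.
have := measurable_fun_fubini_tonelli_F (m2 := P 0) _ mf (fun=> comp_ge0 _).
rewrite /fubini_F /=; under eq_fun do rewrite comp_int//.
move=> /measurable_EFinP H.
rewrite (_ : semigroup_diff h =
   (fun y => (semigroup_diff h y + Q * abs_increment P X h) - Q * abs_increment P X h)).
  exact: measurable_funB.
by apply/funext => y; rewrite addrK.
Qed.

Lemma markov_semigroup_diff x s h (Z : Omega -> R) : 0 <= s -> 0 <= h ->
  (forall B, measurable B -> F s (Z @^-1` B)) ->
  \int[P x]_w (u (Z w + increment X s (s + h) w) - u (Z w)) =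
  \int[P x]_w semigroup_diff h (Z w).
Proof.
move=> s0 h0 FZ.
have mZ : measurable_fun setT Z.
  by move=> _ B mB; rewrite setTI; exact: (filtration_sub hF s0 (FZ B mB)).
have iI := integrable_increment hmean x s0 (addr_ge0 s0 h0).
have idf := integrable_lipschitz_diff mZ iI.
have iQ := integrableZl measurableT Q (integrable_norm iI).
have ip : (P x).-integrable setT (EFin \o (semigroup_diff h \o Z)).
  have := finite_measure_integrable_cst (P x) (Q * abs_increment P X h) measurableT.
  apply: le_integrable => //.
    apply/measurable_EFinP; apply: measurableT_comp mZ.
    exact: measurable_semigroup_diff.
  move=> w _ /=; rewrite lee_fin (le_trans (semigroup_diff_abs _ h0))//.
  exact: ler_norm.
(* The identity is obtained for the compensated integrand. The compensator has the same mean
   [Q * abs_increment P X h] on both sides and cancels at the end, so no integrability of [Z] is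
   involved. *)
have := levy_markov hF hX x s0 h0 FZ mcomp comp_ge0.
under [X in _ = X -> _]eq_integral do rewrite comp_int//.
move=> /(congr1 fine).
have ic := finite_measure_integrable_cst (P x) (Q * abs_increment P X h) measurableT.
have L := RintegralD measurableT idf iQ.
have R' := RintegralD measurableT ip ic.
rewrite -[LHS]/(\int[P x]_w (u (Z w + increment X s (s + h) w) - u (Z w) +
  Q * `|increment X s (s + h) w|)) [LHS]L -[RHS]/(\int[P x]_w (semigroup_diff h (Z w) +
  Q * abs_increment P X h)) [RHS]R'.
rewrite RintegralZl//; last exact: integrable_norm iI.
rewrite (abs_incrementE hF hX x s0 h0) (Rintegral_cst _ measurableT).
by rewrite [X in fine X](@probability_setT _ _ _ (P x)) mulr1; exact: addIr.
Qed.

Lemma integrable_u_X x t : 0 <= t ->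
  (P x).-integrable setT (fun w => (u (X t w))%:E).
Proof.
move=> t0; have iX := hmean x t0.
have := integrable_lipschitz_diff (x := x) (Y := cst 0) (measurable_cst _) iX.
move=> idf; have ic := finite_measure_integrable_cst (P x) (u 0) measurableT.
have := integrableD measurableT idf ic.
by apply: eq_integrable => // w _; rewrite /= -EFinD add0r subrK.
Qed.

Lemma integral_u_X x t : 0 <= t ->
  \int[P x]_w u (X t w) = u x + semigroup_diff t x.
Proof.
move=> t0.
have iI := integrable_increment hmean x (lexx 0) t0.
have idf := integrable_lipschitz_diff (x := x) (Y := cst x) (measurable_cst _) iI.
have ic := finite_measure_integrable_cst (P x) (u x) measurableT.
have E : \int[P x]_w (u (x + increment X 0 t w) - u x) = semigroup_diff t x.
  congr fine.
  have := @integral_increment _ _ _ P F X hF hX x 0 t (fun i => (u (x + i) - u x)%:E) (lexx 0) t0.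
  rewrite add0r; apply.
  by apply/measurable_EFinP; apply: measurable_funB => //; apply: measurableT_comp => //;
    exact: measurable_funD.
have Eu : \int[P x]_w u x = u x.
  rewrite (Rintegral_cst _ measurableT).
  by rewrite [X in fine X](@probability_setT _ _ _ (P x)) mulr1.
rewrite -E -[X in _ = X + _]Eu -(RintegralD measurableT ic idf); congr fine; apply: ae_eq_integral => //.
- exact: measurable_int _ (integrable_u_X x t0).
- exact: measurable_int _ (integrableD measurableT ic idf).
have := levy_start hX x; apply: filterS => w Xw _.
rewrite /increment Xw; congr (_%:E).
by rewrite [RHS]addrC subrK; congr u; rewrite [RHS]addrC subrK.
Qed.

Lemma generator_quotientE y t : 0 < t ->
  generator_quotient P X u y t = semigroup_diff t y / t.
Proof.
move=> t0; rewrite /generator_quotient unlock -/(Rintegral _ _ _).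
by rewrite integral_u_X ?ltW// addrAC subrr add0r.
Qed.

Lemma generator_cvg y : in_generator_domain P X u ->
  n.+1%:R * semigroup_diff n.+1%:R^-1 y @[n --> \oo] --> generator P X u y.
Proof.
move=> /(_ y)[_ cg].
have /cvg_at_rightP := cg => /(_ (fun n => n.+1%:R^-1)) H.
have -> : (fun n => n.+1%:R * semigroup_diff n.+1%:R^-1 y) =
    (fun n => generator_quotient P X u y n.+1%:R^-1).
  by apply/funext => n; rewrite generator_quotientE ?invr_gt0// invrK mulrC.
by apply: H; split; [move=> n; rewrite invr_gt0|exact: cvg_harmonic].
Qed.

End semigroup.

(** * The discounted limit *)

Section discounted.
Context {d : measure_display} {Omega : measurableType d} {R : realType}.
Variables (e : R) (e0 : 0 < e) (Q : probability Omega R).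
Local Notation lam := (exp_law e0).
Local Notation Pi := (exp_law e0 \x Q)%E.

Lemma Rintegral_cst1 d' (T : measurableType d') (p : probability T R) (r : R) :
  \int[p]_x r = r.
Proof.
rewrite (Rintegral_cst _ measurableT).
by rewrite [X in fine X](@probability_setT _ _ _ p) mulr1.
Qed.

Lemma product_setT : Pi setT = 1%E.
Proof.
rewrite -setXTT product_measure1E//.
by rewrite [X in (X * _)%E](@probability_setT _ _ _ lam) mul1e
  [LHS](@probability_setT _ _ _ Q).
Qed.

Lemma integrable_product_cst (r : R) : Pi.-integrable setT (fun=> r%:E).
Proof.
apply/integrableP; split => //.
by rewrite integral_cst// [X in (_ * X)%E]product_setT mule1 ltry.
Qed.

(** Integrability of every section, and not just of almost every one, makes the inner integral
    finite at each [s], so the extended-valued Fubini function is a real function. *)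
Lemma Rintegral_product (f : measurableTypeR R * Omega -> R) :
  Pi.-integrable setT (EFin \o f) ->
  (forall s, Q.-integrable setT (fun w => (f (s, w))%:E)) ->
  lam.-integrable setT (fun s => (\int[Q]_w f (s, w))%:E) /\
  \int[lam]_s (\int[Q]_w f (s, w)) = \int[Pi]_p f p.
Proof.
move=> fi fs.
have E : fubini_F Q (EFin \o f) = fun s => (\int[Q]_w f (s, w))%:E.
  apply/funext => s; rewrite /fubini_F /Rintegral fineK//.
  exact: integrable_fin_num (fs s).
have := integrable_fubini_F fi; rewrite E => H; split => //.
by rewrite /Rintegral -(integral12_prod_meas1 fi) E.
Qed.

(** To be instantiated with the controlled process for [y], the accumulated price of control for
    [B], the quotient of the semigroup difference at step 1/(n+1) for [g n], the generator for [L]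
    and the initial value [u x] for [v]. *)
Variables (y B : R -> Omega -> R) (u c : R -> R) (L : R -> R) (g : nat -> R -> R).
Variables (K v : R).
Hypotheses
  (my : measurable_fun setT (fun p : measurableTypeR R * Omega => y p.1 p.2))
  (iu : Pi.-integrable setT (fun p => (u (y p.1 p.2))%:E))
  (ic : Pi.-integrable setT (fun p => (c (y p.1 p.2))%:E))
  (iB : Pi.-integrable setT (fun p => (B p.1 p.2)%:E))
  (ius : forall s, Q.-integrable setT (fun w => (u (y s w))%:E))
  (iBs : forall s, Q.-integrable setT (fun w => (B s w)%:E))
  (mg : forall n, measurable_fun setT (g n))
  (gK : forall n z, - K <= g n z)
  (gM : forall n, exists M : R, forall z, `|g n z| <= M)
  (gL : forall z, g n z @[n --> \oo] --> L z)
  (Lc : forall z, e * u z - c z <= L z)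
  (step : forall n (s : R), 0 <= s ->
    \int[Q]_w (u (y s w) + B s w) + n.+1%:R^-1 * \int[Q]_w g n (y s w) <=
    \int[Q]_w (u (y (s + n.+1%:R^-1) w) + B (s + n.+1%:R^-1) w))
  (start : forall n s, s < n.+1%:R^-1 ->
    v - K / n.+1%:R <= \int[Q]_w (u (y s w) + B s w)).

Let V (p : measurableTypeR R * Omega) := u (y p.1 p.2) + B p.1 p.2.

Let iV : Pi.-integrable setT (EFin \o V).
Proof. by apply: eq_integrable (integrableD measurableT iu iB). Qed.

Let iVs s : Q.-integrable setT (fun w => (V (s, w))%:E).
Proof. by apply: eq_integrable (integrableD measurableT (ius s) (iBs s)). Qed.

Let psi s := \int[Q]_w V (s, w).

Let mys s : measurable_fun setT (y s).
Proof. exact: measurableT_comp my (measurable_pair1 s). Qed.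

Let ig n : Pi.-integrable setT (fun p => (g n (y p.1 p.2))%:E).
Proof.
have [M gMn] := gM n.
have := integrable_product_cst M.
apply: le_integrable => //.
  by apply/measurable_EFinP; exact: measurableT_comp.
by move=> p _ /=; rewrite lee_fin (le_trans (gMn _))// ler_norm.
Qed.

Let igs n s : Q.-integrable setT (fun w => (g n (y s w))%:E).
Proof.
have [M gMn] := gM n.
have := finite_measure_integrable_cst Q M measurableT.
apply: le_integrable => //.
  by apply/measurable_EFinP; apply: measurableT_comp.
by move=> p _ /=; rewrite lee_fin (le_trans (gMn _))// ler_norm.
Qed.

(** With h = 1/(n+1), [step] is integrated over time against the exponential law and
    [exp_law_shift_le] removes the shift by [h]. That lemma wants a function nonnegative before [h];
    subtracting [v'], the lower bound provided by [start], achieves this. Division by [h] then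
    isolates [g n]. *)
Lemma discounted_step n :
  \int[Pi]_p g n (y p.1 p.2) <=
  n.+1%:R * (expR (e * n.+1%:R^-1) - 1) * (\int[Pi]_p V p - (v - K / n.+1%:R)).
Proof.
set h := n.+1%:R^-1; set v' := v - _.
have h0 : 0 < h by rewrite invr_gt0.
have [iG EG] := Rintegral_product (ig n) (igs n).
have [ip Ep] := Rintegral_product iV iVs.
have icst := finite_measure_integrable_cst lam v' measurableT.
have ipv : lam.-integrable setT (EFin \o (fun s => psi s - v')).
  by apply: eq_integrable (integrableB measurableT ip icst).
have [|ish sh] := exp_law_shift_le (ltW h0) ipv.
  by move=> s sh; rewrite subr_ge0; exact: start.
have iphG : lam.-integrable setT (EFin \o (fun s => (psi s - v') + h * \int[Q]_w g n (y s w))).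
  by apply: eq_integrable (integrableD measurableT ipv (integrableZl measurableT h iG)).
have := exp_law_le_Rintegral iphG ish.
move=> /(_ _)/wrap[s s0|].
  by rewrite addrAC lerB// step.
have iz : lam.-integrable setT (EFin \o (fun s => h * \int[Q]_w g n (y s w))).
  by apply: eq_integrable (integrableZl measurableT h iG).
rewrite (RintegralD measurableT ipv iz) => /le_trans/(_ sh).
rewrite (RintegralZl h measurableT iG) EG.
rewrite (RintegralB measurableT ip icst) Ep Rintegral_cst1.
set S := (X in X + _); rewrite -lerBrDl => H.
rewrite -mulrA -ler_pdivrMl ?ltr0n// -/h; apply: le_trans H _.
by rewrite mulrBl mul1r.
Qed.

(** The limit of the steps is that the integral of e u - c is at most e (W - v), where W is the
    integral of u + B. The integral of e u, being finite, cancels from both sides and leaves only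
    [c] and [e * B]. *)
Lemma discounted_limit :
  e * v <= \int[Pi]_p (c (y p.1 p.2) + e * B p.1 p.2).
Proof.
pose f n (p : measurableTypeR R * Omega) : \bar R := (g n (y p.1 p.2) + K)%:E.
have icK := integrable_product_cst K.
have mf n : measurable_fun setT (f n).
  apply/measurable_EFinP; apply: measurable_funD => //.
  exact: (measurableT_comp (mg n) my).
have f0 n p : (0 <= f n p)%E by rewrite lee_fin -lerBlDr sub0r.
have fE n : (\int[Pi]_p f n p)%E = (\int[Pi]_p g n (y p.1 p.2) + K)%:E.
  have ifn := integrableD measurableT (ig n) icK.
  rewrite -(@fineK _ (\int[Pi]_p f n p)%E); last exact: integrable_fin_num ifn.
  congr (_%:E); rewrite -[LHS]/(\int[Pi]_p (g n (y p.1 p.2) + K)).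
  rewrite (RintegralD measurableT (ig n) icK); congr (_ + _).
  rewrite (Rintegral_cst _ measurableT).
  by rewrite [X in fine X]product_setT mulr1.
pose lo (p : measurableTypeR R * Omega) := e * u (y p.1 p.2) - c (y p.1 p.2).
have ilo : Pi.-integrable setT (EFin \o lo).
  by apply: eq_integrable (integrableB measurableT (integrableZl measurableT e iu) ic).
have loE : (\int[Pi]_p (lo p + K)%:E)%E = (\int[Pi]_p lo p + K)%:E.
  have iloK := integrableD measurableT ilo icK.
  rewrite -(@fineK _ (\int[Pi]_p (lo p + K)%:E)%E); last exact: integrable_fin_num iloK.
  congr (_%:E); rewrite -[LHS]/(\int[Pi]_p (lo p + K)).
  rewrite (RintegralD measurableT ilo icK); congr (_ + _).
  rewrite (Rintegral_cst _ measurableT).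
  by rewrite [X in fine X]product_setT mulr1.
set W := \int[Pi]_p V p.
have main : ((\int[Pi]_p lo p + K)%:E <= (e * (W - v) + K)%:E)%E.
  rewrite -loE; apply: le_trans (le_trans (_ : _ <= _)%E (fatou Pi measurableT mf (fun n p _ => f0 n p))) _.
    apply: le_integral_pointwise => p.
    have fL : f n p @[n --> \oo] --> (L (y p.1 p.2) + K)%:E.
      apply: cvg_EFin; first exact: nearW.
      by apply: cvgD; [exact: gL|exact: cvg_cst].
    by rewrite (cvg_limn_einf_sup fL).1 lee_fin lerD2r; exact: Lc.
  apply: (@limn_einf_le _ _ (fun n => n.+1%:R * (expR (e * n.+1%:R^-1) - 1) *
     (W - (v - K / n.+1%:R)) + K)).
    by move=> n; rewrite fE lee_fin lerD2r discounted_step.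
  apply: cvgD; last exact: cvg_cst.
  apply: cvgM; first exact: cvg_expR_quotient.
  apply: cvgB; first exact: cvg_cst.
  rewrite -[X in _ --> X]subr0; apply: cvgB; first exact: cvg_cst.
  by rewrite -(mulr0 K); apply: cvgM; [exact: cvg_cst|exact: cvg_harmonic].
move: main; rewrite lee_fin lerD2r.
have iceB : Pi.-integrable setT (EFin \o (fun p : measurableTypeR R * Omega => e * B p.1 p.2)).
  by apply: eq_integrable (integrableZl measurableT e iB).
have ieu : Pi.-integrable setT (EFin \o (fun p : measurableTypeR R * Omega => e * u (y p.1 p.2))).
  by apply: eq_integrable (integrableZl measurableT e iu).
rewrite (RintegralB measurableT ieu ic) /W (RintegralD measurableT iu iB).
rewrite (RintegralD measurableT ic iceB) (RintegralZl e measurableT iu) (RintegralZl e measurableT iB).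
lra.
Qed.

End discounted.

(** * The verification inequality *)

Section adapted.
Context {d : measure_display} {Omega : measurableType d} {R : realType}.
Variables (P : R -> probability Omega R) (F : R -> set (set Omega)).

(** Measurability of sums and differences is used on the space carrying [F t] itself: the
    sigma-algebra generated by [F t] is [F t]. *)
Lemma adapted_controlled (X U D : R -> Omega -> R) : filtration P F ->
  adapted F X -> adapted F U -> adapted F D ->
  adapted F (controlled_process X U D).
Proof.
move=> hF aX aU aD t t0 B mB.
have FE : <<s F t >> = F t by rewrite (sigma_algebra_id (filtration_sigma hF t0)).
pose T := g_sigma_algebraType (F t).
have mA (Z : R -> Omega -> R) : adapted F Z -> measurable_fun setT (Z t : T -> R).
  by move=> aZ _ C mC; rewrite setTI; apply: sub_sigma_algebra; exact: aZ.
have : measurable_fun setT (controlled_process X U D t : T -> R).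
  by apply: measurable_funB; [apply: measurable_funD|]; exact: mA.
by move=> /(_ measurableT B mB); rewrite setTI /measurable/= FE.
Qed.

End adapted.

Section verification.
Context {d : measure_display} {Omega : measurableType d} {R : realType}.
Variables (P : R -> probability Omega R) (F : R -> set (set Omega))
  (X : R -> Omega -> R).
Hypotheses (hF : filtration P F) (hX : levy_process P F X) (hmean : finite_mean P X).
Variables (u c : R -> R) (qu qd e delta : R).
Hypotheses (cu : convex_on_R u) (du : forall x, derivable u x 1)
  (qu0 : 0 < qu) (qd0 : 0 < qd) (e0 : 0 < e) (delta0 : 0 < delta)
  (hs : forall x, - qu <= derive1 u x <= qd)
  (hdom : in_generator_domain P X u)
  (hineq : forall x, 0 <= generator P X u x - e * u x + c x)
  (mc : measurable_fun setT c) (c_ge : forall x, - delta <= c x).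
Variables (x : R) (U D : R -> Omega -> R).
Hypotheses (hU : control_component F (P x) U) (hD : control_component F (P x) D).
Variable N : set Omega.
Hypotheses (mN : measurable N) (PN : P x N = 0)
  (startN : forall w, ~ N w -> X 0 w = x)
  (rcX : forall w, ~ N w -> right_continuous_path (X ^~ w))
  (rcU : forall w, ~ N w -> right_continuous_path (U ^~ w))
  (rcD : forall w, ~ N w -> right_continuous_path (D ^~ w))
  (ndU : forall w, ~ N w -> nondecreasing_path (U ^~ w))
  (ndD : forall w, ~ N w -> nondecreasing_path (D ^~ w)).

Local Notation Q := (qu + qd).
Local Notation lam := (exp_law e0).
Local Notation Pi := (exp_law e0 \x P x)%E.
Local Notation Y := (controlled_process X U D).

Definition control_charge (s : R) (w : Omega) : R := qu * U s w + qd * D s w.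
Local Notation B := control_charge.

(* All paths of [tame Z] are right-continuous, which makes it jointly measurable. *)
Definition tame (Z : R -> Omega -> R) (s : R) : Omega -> R :=
  vanish_on N Z (Order.max 0 s).

Let max0 (s : R) : 0 <= Order.max 0 s. Proof. by rewrite le_max lexx. Qed.

Let tameE (Z : R -> Omega -> R) (s : R) (w : Omega) : 0 <= s -> ~ N w -> tame Z s w = Z s w.
Proof. by move=> s0 Nw; rewrite /tame vanish_on_notin// max_r. Qed.

Let mX (t : R) : 0 <= t -> measurable_fun setT (X t).
Proof. exact: (measurable_levy hF hX). Qed.
Let mU (t : R) : 0 <= t -> measurable_fun setT (U t).
Proof. exact: adapted_measurable hF (control_adapted hU). Qed.
Let mD (t : R) : 0 <= t -> measurable_fun setT (D t).
Proof. exact: adapted_measurable hF (control_adapted hD). Qed.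
Let aY : adapted F Y.
Proof.
exact: adapted_controlled hF (levy_adapted hX) (control_adapted hU) (control_adapted hD).
Qed.
Let mY (t : R) : 0 <= t -> measurable_fun setT (Y t).
Proof. exact: adapted_measurable hF aY. Qed.
Let mB (t : R) : 0 <= t -> measurable_fun setT (B t).
Proof.
by move=> t0; apply: measurable_funD; apply: measurable_funM => //;
  [exact: mU|exact: mD].
Qed.

Let tame_joint (Z : R -> Omega -> R) : (forall t : R, 0 <= t -> measurable_fun setT (Z t)) ->
  (forall w, ~ N w -> right_continuous_path (Z ^~ w)) ->
  measurable_fun setT (fun p : measurableTypeR R * Omega => tame Z p.1 p.2).
Proof.
move=> mZ rcZ; apply: measurable_right_continuous_process.
  by move=> t t0; apply: measurable_vanish_on => //; exact: mZ.
exact: vanish_on_right_continuous.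
Qed.

Let jX := tame_joint mX rcX.
Let jU := tame_joint mU rcU.
Let jD := tame_joint mD rcD.
Let jY : measurable_fun setT (fun p : measurableTypeR R * Omega => tame Y p.1 p.2).
Proof.
apply: tame_joint => // w Nw t t0; apply: cvgB; last exact: rcD.
by apply: cvgD; [exact: rcX|exact: rcU].
Qed.
Let jB : measurable_fun setT (fun p : measurableTypeR R * Omega => tame B p.1 p.2).
Proof.
apply: tame_joint => // w Nw t t0; apply: cvgD; apply: cvgM => //.
- exact: cvg_cst.
- exact: rcU.
- exact: cvg_cst.
- exact: rcD.
Qed.

Let U_ge0 (t : R) w : 0 <= t -> 0 <= U t w. Proof. exact: (control_ge0 hU). Qed.
Let D_ge0 (t : R) w : 0 <= t -> 0 <= D t w. Proof. exact: (control_ge0 hD). Qed.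

Let B_ge0 s w : 0 <= tame B s w.
Proof.
rewrite /tame /vanish_on mulr_ge0//.
by rewrite addr_ge0// mulr_ge0 ?(ltW qu0) ?(ltW qd0) ?U_ge0 ?D_ge0.
Qed.

Let lip y z : `|u z - u y| <= Q * `|z - y|.
Proof. exact: slope_lip. Qed.
Let mu_ : measurable_fun setT u. Proof. exact: measurable_derivable. Qed.

Let iB_true (t : R) : 0 <= t -> (P x).-integrable setT (EFin \o B t).
Proof.
move=> t0; have iU := control_integrable hU t0; have iD := control_integrable hD t0.
by apply: eq_integrable (integrableD measurableT (integrableZl measurableT qu iU)
  (integrableZl measurableT qd iD)).
Qed.

Let iY_true (t : R) : 0 <= t -> (P x).-integrable setT (EFin \o Y t).
Proof.
move=> t0; have iU := control_integrable hU t0; have iD := control_integrable hD t0.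
by apply: eq_integrable (integrableB measurableT (integrableD measurableT (hmean x t0) iU) iD).
Qed.

Let iu_comp (Z : Omega -> R) : measurable_fun setT Z -> (P x).-integrable setT (EFin \o Z) ->
  (P x).-integrable setT (fun w => (u (Z w))%:E).
Proof.
move=> mZ iZ.
have ic := finite_measure_integrable_cst (P x) `|u 0| measurableT.
have := integrableD measurableT ic (integrableZl measurableT Q (integrable_norm iZ)).
apply: le_integrable => //; first by apply/measurable_EFinP; exact: measurableT_comp.
move=> w _ /=; rewrite lee_fin [leRHS]ger0_norm; last first.
  by rewrite addr_ge0// mulr_ge0// addr_ge0 ?(ltW qu0) ?(ltW qd0).
rewrite -lerBlDl; apply: le_trans (lerB_dist _ _) _.
by apply: le_trans (lip _ _) _; rewrite subr0.
Qed.

Let vanish_le (Z : R -> Omega -> R) (t : R) (w : Omega) : `|vanish_on N Z t w| <= `|Z t w|.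
Proof.
rewrite /vanish_on normrM indicE; case: (_ \in _) => /=; rewrite ?normr1 ?mulr1//.
by rewrite normr0 mulr0.
Qed.

Let i_tame (Z : R -> Omega -> R) (s : R) : (forall t : R, 0 <= t -> measurable_fun setT (Z t)) ->
  (forall t : R, 0 <= t -> (P x).-integrable setT (EFin \o Z t)) ->
  (P x).-integrable setT (EFin \o tame Z s).
Proof.
move=> mZ iZ; have := iZ _ (max0 s); apply: le_integrable => //.
  by apply/measurable_EFinP; apply: measurable_vanish_on => //; exact: mZ.
by move=> w _ /=; rewrite lee_fin; exact: vanish_le.
Qed.

Let m_tame (Z : R -> Omega -> R) (s : R) : (forall t : R, 0 <= t -> measurable_fun setT (Z t)) ->
  measurable_fun setT (tame Z s).
Proof. by move=> mZ; apply: measurable_vanish_on => //; exact: mZ. Qed.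

Let iV s : (P x).-integrable setT (EFin \o (fun w => u (tame Y s w) + tame B s w)).
Proof.
have h1 := iu_comp (m_tame s mY) (i_tame s mY iY_true).
by apply: eq_integrable (integrableD measurableT h1 (i_tame s mB iB_true)).
Qed.

Let sd := semigroup_diff P X u.

Let msd h : 0 <= h -> measurable_fun setT (sd h).
Proof. by move=> h0; exact: (measurable_semigroup_diff hF hX hmean cu du qu0 qd0 hs). Qed.

Let isd h (Z : Omega -> R) : 0 <= h -> measurable_fun setT Z ->
  (P x).-integrable setT (EFin \o (fun w => sd h (Z w))).
Proof.
move=> h0 mZ.
have := finite_measure_integrable_cst (P x) (Q * abs_increment P X h) measurableT.
apply: le_integrable => //.
  by apply/measurable_EFinP; exact: (measurableT_comp (msd h0)).
move=> w _ /=; rewrite lee_fin.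
by apply: le_trans (ler_norm _); exact: semigroup_diff_abs.
Qed.

(** The move from [s] to [s + h] is split in two: the process jumps by its increment with the
    control frozen, which the Markov identity evaluates, and then the increments of [U] and [D] act,
    which [slope_lower] charges to [B]. *)
Lemma control_step (s h : R) : 0 <= s -> 0 <= h ->
  \int[P x]_w (u (tame Y s w) + tame B s w) + \int[P x]_w sd h (tame Y s w) <=
  \int[P x]_w (u (tame Y (s + h) w) + tame B (s + h) w).
Proof.
move=> s0 h0; have sh0 := addr_ge0 s0 h0.
have iI := integrable_increment hmean x s0 sh0.
have id := integrable_lipschitz_diff cu du qu0 qd0 hs (mY s0) iI.
(* [tame Y s] need not be measurable for [F s], so the adapted [Y s] replaces it before independence
   is used. *)
have E : \int[P x]_w sd h (tame Y s w) <= \int[P x]_w sd h (Y s w).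
  apply: (ae_le_Rintegral mN PN); [exact: (isd h0 (m_tame s mY))|exact: (isd h0 (mY s0))|].
  by move=> w Nw; rewrite tameE.
apply: le_trans (lerD (lexx _) E) _.
rewrite -(markov_semigroup_diff hF hX hmean cu du qu0 qd0 hs x s0 h0 (aY s0)).
have id' : (P x).-integrable setT
   (EFin \o (fun w => u (Y s w + increment X s (s + h) w) - u (Y s w))) by exact: id.
rewrite -(RintegralD measurableT (iV s) id').
apply: (ae_le_Rintegral mN PN).
- by apply: eq_integrable (integrableD measurableT (iV s) id').
- exact: iV.
move=> w Nw; rewrite !tameE// /B.
have dU : 0 <= U (s + h) w - U s w by rewrite subr_ge0; apply: ndU => //; rewrite lerDl.
have dD : 0 <= D (s + h) w - D s w by rewrite subr_ge0; apply: ndD => //; rewrite lerDl.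
have := slope_lower cu du hs (Y s w + increment X s (s + h) w) dU dD.
rewrite (_ : Y s w + _ + _ - _ = Y (s + h) w); last first.
  by rewrite /controlled_process /increment; ring.
by lra.
Qed.

(** All of the control up to [t], including its initial value, is treated as one push applied to
    X_t; the expectation of u(X_t) is then bounded by the tangent at [x]. *)
Lemma control_start (s t : R) : t = Order.max 0 s ->
  u x - Q * `|mean_increment P X t| <= \int[P x]_w (u (tame Y s w) + tame B s w).
Proof.
move=> tE; have t0 : 0 <= t by rewrite tE.
apply: (@le_trans _ _ (\int[P x]_w u (X t w))).
  rewrite (integral_u_X hF hX hmean cu du qu0 qd0 hs x t0) lerD2l.
  exact: (semigroup_diff_ge hmean cu du qu0 qd0 hs).
apply: (ae_le_Rintegral mN PN).
- exact: (integrable_u_X hmean cu du qu0 qd0 hs x t0).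
- exact: iV.
move=> w Nw; rewrite /tame !vanish_on_notin// -tE /B.
have := slope_lower cu du hs (X t w) (U_ge0 w t0) (D_ge0 w t0).
rewrite -[X t w + U t w - D t w]/(Y t w); lra.
Qed.

(** E|X_s - x| grows at most linearly in s, and the exponential law has a finite mean. *)
Lemma integrable_product_levy :
  Pi.-integrable setT (fun p => (tame X p.1 p.2 - x)%:E).
Proof.
have mf : measurable_fun setT (fun p : measurableTypeR R * Omega => (tame X p.1 p.2 - x)%:E).
  by apply/measurable_EFinP; exact: measurable_funB.
apply: (proj2 (@integrable12ltyP _ _ _ _ _ lam (P x) _ mf)).
have [C C0 [bC _]] := increment_bounds hF hX hmean.
have inner (s : R) : (\int[P x]_w `|(tame X s w - x)%:E| <=
    C%:E * (1 + Order.max 0 s)%:E)%E.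
  have iI := integrable_abs_increment hmean x (lexx 0) (max0 s).
  apply: (@le_trans _ _ (abs_increment P X (Order.max 0 s))%:E); last first.
    by rewrite -EFinM lee_fin; exact: bC.
  rewrite -(abs_incrementE hF hX x (lexx 0) (max0 s)) add0r /Rintegral fineK; last first.
    exact: integrable_fin_num iI.
  have mTX : measurable_fun setT (tame X s) := m_tame s mX.
  rewrite [leLHS](@ge0_ae_eq_integral _ _ _ (P x) setT _ (fun w => `|increment X 0 (Order.max 0 s) w|%:E))//.
  - by apply: measurableT_comp => //; apply/measurable_EFinP; exact: measurable_funB.
  - exact: measurable_int iI.
  exists N; split => //= w /= H; apply: contrapT => Nw; apply: H => _.
  by rewrite /tame vanish_on_notin// /increment startN.
apply: (@le_lt_trans _ _ (\int[lam]_s (C%:E * (1 + Order.max 0 s)%:E))%E).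
  exact: le_integral_pointwise.
rewrite ge0_integralZl//.
- by rewrite lte_mul_pinfty// integral_exp_law_affine.
- by apply/measurable_EFinP; apply: measurable_funD => //; exact: measurable_maxr.
- by move=> s _; rewrite lee_fin addr_ge0.
Qed.

(** The term [delta] makes the cost nonnegative, and [e * tame B] is what the Stieltjes integrals
    and the initial charge become under the exponential law, up to the normalising factor 1/e. *)
Definition running_cost (p : measurableTypeR R * Omega) : R :=
  c (tame Y p.1 p.2) + delta + e * tame B p.1 p.2.

Lemma running_cost_ge0 p : 0 <= running_cost p.
Proof.
rewrite /running_cost addr_ge0//; first by rewrite -lerBlDr sub0r.
by rewrite mulr_ge0 ?(ltW e0).
Qed.

Lemma measurable_running_cost : measurable_fun setT running_cost.
Proof.
apply: measurable_funD; last by apply: measurable_funM => //; exact: jB.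
by apply: measurable_funD => //; exact: measurableT_comp jY.
Qed.

(** Integrability propagates from the cost: nonnegativity of c + delta bounds [B], positivity of
    [qu] and [qd] then bounds [U] and [D], these together with the mean of [X] bound [Y], and the
    Lipschitz bound reaches u(Y). *)
Lemma verification_product : Pi.-integrable setT (EFin \o running_cost) ->
  e * u x + delta <= \int[Pi]_p running_cost p.
Proof.
move=> iH.
have icst r := integrable_product_cst e0 (P x) r.
have ic : Pi.-integrable setT (fun p => (c (tame Y p.1 p.2))%:E).
  apply: le_integrable (integrableD measurableT iH (icst delta)) => //.
    by apply/measurable_EFinP; exact: measurableT_comp jY.
  move=> p _ /=; rewrite lee_fin [leRHS]ger0_norm; last first.
    by rewrite addr_ge0 ?running_cost_ge0 ?ltW.
  have := c_ge (tame Y p.1 p.2); have := B_ge0 p.1 p.2; rewrite /running_cost => b0 cd.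
  have eb0 : 0 <= e * tame B p.1 p.2 by rewrite mulr_ge0 ?(ltW e0).
  by rewrite ler_norml; have := delta0; lra.
have iB : Pi.-integrable setT (fun p => (tame B p.1 p.2)%:E).
  apply: le_integrable (integrableZl measurableT e^-1 iH) => //.
    by apply/measurable_EFinP.
  move=> p _ /=; rewrite lee_fin ger0_norm// ger0_norm; last first.
    by rewrite mulr_ge0 ?invr_ge0 ?(ltW e0) ?running_cost_ge0.
  rewrite ler_pdivlMl// /running_cost lerDr -lerBlDr sub0r; exact: c_ge.
have iu : Pi.-integrable setT (fun p => (u (tame Y p.1 p.2))%:E).
  have i1 := integrable_norm integrable_product_levy.
  (* Since B = qu U + qd D with nonnegative terms, [U] is at most [qu^-1 * B] and [D] at most
     [qd^-1 * B]. *)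
  have i2 := integrableZl measurableT (qu^-1 + qd^-1) iB.
  have i3 := integrableZl measurableT Q (integrableD measurableT (integrableD measurableT i1 i2) (icst (2 * `|x|))).
  apply: le_integrable (integrableD measurableT i3 (icst `|u 0|)) => //.
    by apply/measurable_EFinP; exact: measurableT_comp jY.
  move=> [s w] _ /=; rewrite lee_fin.
  apply: le_trans (ler_norm _).
  rewrite -lerBlDr; apply: le_trans (lerB_dist _ _) _.
  apply: le_trans (lip _ _) _; rewrite subr0; apply: ler_wpM2l.
    by rewrite addr_ge0 ?(ltW qu0) ?(ltW qd0).
  have [Nw|Nw] := pselect (N w).
    rewrite [tame Y _ _]vanish_on_in// normr0 addr_ge0 ?mulr_ge0//.
    by rewrite addr_ge0// mulr_ge0// addr_ge0// invr_ge0 ltW.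
  rewrite /tame !vanish_on_notin//; set t := Order.max 0 s.
  have t0 : 0 <= t by exact: max0.
  have eY : Y t w = (X t w - x) + x + U t w - D t w by rewrite /controlled_process; ring.
  have b1 : U t w <= qu^-1 * B t w.
    by rewrite ler_pdivlMl// /B lerDl mulr_ge0 ?(ltW qd0) ?D_ge0.
  have b2 : D t w <= qd^-1 * B t w.
    by rewrite ler_pdivlMl// /B lerDr mulr_ge0 ?(ltW qu0) ?U_ge0.
  rewrite eY; apply: (@le_trans _ _ (`|X t w - x| + `|x| + U t w + D t w)).
    apply: le_trans (ler_normB _ _) _; rewrite (ger0_norm (D_ge0 w t0)) lerD2r.
    apply: le_trans (ler_normD _ _) _; rewrite (ger0_norm (U_ge0 w t0)) lerD2r.
    exact: ler_normD.
  by rewrite mulrDl; have := normr_ge0 x; lra.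
have [C C0 [_ mC]] := increment_bounds hF hX hmean.
have Q0 : 0 <= Q by rewrite addr_ge0 ?(ltW qu0) ?(ltW qd0).
pose g n z : R := n.+1%:R * sd n.+1%:R^-1 z.
have nV0 (n : nat) : 0 <= n.+1%:R^-1 :> R by rewrite invr_ge0.
(* The constant [Q * C] comes from the tangent bound - Q |m(h)| on the semigroup difference, where m
   is the mean increment and |m(h)| <= C h for h = 1/(n+1). The same estimate, valid for all times
   in [0, h], gives the hypothesis [start]. *)
have lim := @discounted_limit _ _ _ e e0 (P x) (tame Y) (tame B) u c (generator P X u) g
  (Q * C) (u x) jY iu ic iB.
have {lim} : e * u x <= \int[Pi]_p (c (tame Y p.1 p.2) + e * tame B p.1 p.2).
  apply: lim.
  - move=> s; exact: iu_comp (m_tame s mY) (i_tame s mY iY_true).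
  - move=> s; exact: i_tame s mB iB_true.
  - by move=> n; apply: measurable_funM => //; exact: msd.
  - move=> n z; rewrite /g.
    have := semigroup_diff_ge hmean cu du qu0 qd0 hs z (nV0 n).
    have mn : `|mean_increment P X n.+1%:R^-1| <= C / n.+1%:R.
      by apply: mC; rewrite nV0 lexx.
    rewrite -ler_pdivrMl ?ltr0n//; apply: le_trans.
    by rewrite mulrN lerN2 mulrCA ler_wpM2l// mulrC.
  - move=> n; exists (n.+1%:R * (Q * abs_increment P X n.+1%:R^-1)) => z.
    rewrite /g normrM normr_nat ler_wpM2l//.
    exact: semigroup_diff_abs.
  - by move=> z; apply: (generator_cvg hF hX hmean cu du qu0 qd0 hs).
  - by move=> z; have := hineq z; lra.
  - move=> n s s0.
    apply: le_trans (control_step s0 (nV0 n)); rewrite lerD2l /g.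
    by rewrite (RintegralZl _ measurableT (isd (nV0 n) (m_tame s mY))) mulrA mulVf ?mul1r ?pnatr_eq0.
  - move=> n s sn.
    apply: le_trans (control_start (erefl (Order.max 0 s))).
    rewrite lerD2l lerN2 -mulrA ler_wpM2l//; apply: mC.
    by rewrite max0 ge_max nV0 ltW.
have iceB : Pi.-integrable setT (EFin \o (fun p : measurableTypeR R * Omega =>
    c (tame Y p.1 p.2) + e * tame B p.1 p.2)).
  by apply: eq_integrable (integrableD measurableT ic (integrableZl measurableT e iB)).
rewrite (_ : \int[Pi]_p running_cost p =
    \int[Pi]_p ((c (tame Y p.1 p.2) + e * tame B p.1 p.2) + delta)).
  rewrite (RintegralD measurableT iceB (icst delta)).
  rewrite (Rintegral_cst _ measurableT) [X in fine X]product_setT mulr1.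
  by rewrite lerD2r.
by apply: eq_Rintegral => p _; rewrite /running_cost; ring.
Qed.

Definition path_cost (w : Omega) : \bar R :=
  (\int[lebesgue_measure]_(s in `]0%R, +oo[) (expR (- e * s) * c (Y s w))%:E
   + qu%:E * stieltjes_integral (U ^~ w) (fun s => expR (- e * s))
   + qd%:E * stieltjes_integral (D ^~ w) (fun s => expR (- e * s))
   + (qu * U 0%R w + qd * D 0%R w)%:E)%E.

Let discount_delta : (\int[@lebesgue_measure R]_(s in `]0%R, +oo[)
  (expR (- e * s) * delta)%:E = (delta / e)%:E)%E.
Proof.
rewrite (ge0_integral_expR_weight e0 (phi := cst delta))//; last by move=> s; exact: ltW.
rewrite -[X in (_ * X)%E]/(\int[lam]_s (cst delta%:E s))%E integral_cst//.
by rewrite [X in (_ * (_ * X))%E](@probability_setT _ _ _ lam) mule1 -EFinM mulrC.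
Qed.

Let integrable_discount_delta : (@lebesgue_measure R).-integrable (`]0%R, +oo[%classic : set R)
  (EFin \o (fun s => expR (- e * s) * delta)).
Proof.
apply/integrableP; split.
  apply: measurable_funTS; apply/measurable_EFinP; apply: measurable_funM => //.
  by apply: measurableT_comp => //; exact: measurable_funM.
under eq_integral do rewrite /= ger0_norm ?mulr_ge0 ?expR_ge0 ?(ltW delta0)//.
by rewrite discount_delta ltry.
Qed.

(** Averaging B_s = qu (U_s - U_0) + qd (D_s - D_0) + B_0 under the exponential law yields the two
    Stieltjes integrals plus the initial charge. Every term but [delta / e] is nonnegative, so the
    rearrangement is legitimate when some of them are infinite. *)
Lemma path_costE w : ~ N w ->
  path_cost w = ((e^-1)%:E * \int[lam]_s (running_cost (s, w))%:E - (delta / e)%:E)%E.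
Proof.
move=> Nw.
have mpair : measurable_fun setT (fun s : measurableTypeR R => (s, w)) by exact: measurable_pair2.
have mTY : measurable_fun setT (fun s : measurableTypeR R => tame Y s w) by exact: measurableT_comp jY mpair.
have mTB : measurable_fun setT (fun s : measurableTypeR R => tame B s w) by exact: measurableT_comp jB mpair.
have mTU : measurable_fun setT (fun s : measurableTypeR R => tame U s w) by exact: measurableT_comp jU mpair.
have mTD : measurable_fun setT (fun s : measurableTypeR R => tame D s w) by exact: measurableT_comp jD mpair.
pose phi s := c (tame Y s w) + delta.
have mphi : measurable_fun setT phi.
  by apply: measurable_funD => //; exact: (measurableT_comp mc mTY).
have phi0 s : 0 <= phi s by rewrite /phi -lerBlDr sub0r.
have run : (\int[lebesgue_measure]_(s in `]0%R, +oo[) (expR (- e * s) * c (Y s w))%:E =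
    (e^-1)%:E * \int[lam]_s (phi s)%:E - (delta / e)%:E)%E.
  rewrite -(ge0_integral_expR_weight e0 mphi phi0) -discount_delta.
  rewrite -(ge0_integralB_integrable _ _ _ integrable_discount_delta)//.
  - apply: eq_integral => s; rewrite inE/= in_itv/= andbT => s0.
    rewrite -EFinB; congr (_%:E); rewrite /phi tameE ?ltW//; ring.
  - apply: measurable_funTS; apply/measurable_EFinP; apply: measurable_funM => //.
    by apply: measurableT_comp => //; exact: measurable_funM.
  - by move=> s _; rewrite lee_fin mulr_ge0 ?expR_ge0.
  - by move=> s _; rewrite mulr_ge0 ?expR_ge0 ?(ltW delta0).
have stU := stieltjes_integral_expR e0 (ndU Nw) (rcU Nw).
have stD := stieltjes_integral_expR e0 (ndD Nw) (rcD Nw).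
have dU s : 0 <= U (Order.max 0 s) w - U 0 w by rewrite subr_ge0; exact: ndU.
have dD s : 0 <= D (Order.max 0 s) w - D 0 w by rewrite subr_ge0; exact: ndD.
have mdU : measurable_fun setT (fun s : R => (U (Order.max 0 s) w - U 0 w)%:E).
  apply/measurable_EFinP; apply: measurable_funB => //.
  by apply: eq_measurable_fun mTU => s _; rewrite /tame vanish_on_notin.
have mdD : measurable_fun setT (fun s : R => (D (Order.max 0 s) w - D 0 w)%:E).
  apply/measurable_EFinP; apply: measurable_funB => //.
  by apply: eq_measurable_fun mTD => s _; rewrite /tame vanish_on_notin.
have r0 : 0 <= qu * U 0 w + qd * D 0 w.
  by rewrite addr_ge0// mulr_ge0 ?(ltW qu0) ?(ltW qd0) ?U_ge0 ?D_ge0.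
have bE : (\int[lam]_s (tame B s w)%:E =
   qu%:E * stieltjes_integral (U ^~ w) (fun s => expR (- e * s)) +
   qd%:E * stieltjes_integral (D ^~ w) (fun s => expR (- e * s)) +
   (qu * U 0%R w + qd * D 0%R w)%:E)%E.
  have rE : (\int[lam]_s (cst (qu * U 0 w + qd * D 0 w)%:E s) = (qu * U 0 w + qd * D 0 w)%:E)%E.
    by rewrite integral_cst// [X in (_ * X)%E](@probability_setT _ _ _ lam) mule1.
  have zU : (\int[lam]_s (qu%:E * (U (Order.max 0 s) w - U 0 w)%:E) =
      qu%:E * \int[lam]_s (U (Order.max 0 s) w - U 0 w)%:E)%E.
    by rewrite ge0_integralZl// => [s _|]; rewrite lee_fin// ltW.
  have zD : (\int[lam]_s (qd%:E * (D (Order.max 0 s) w - D 0 w)%:E) =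
      qd%:E * \int[lam]_s (D (Order.max 0 s) w - D 0 w)%:E)%E.
    by rewrite ge0_integralZl// => [s _|]; rewrite lee_fin// ltW.
  have pU s : (0 <= qu%:E * (U (Order.max 0 s) w - U 0 w)%:E)%E.
    by rewrite mule_ge0// lee_fin// ltW.
  have pD s : (0 <= qd%:E * (D (Order.max 0 s) w - D 0 w)%:E)%E.
    by rewrite mule_ge0// lee_fin// ltW.
  have mzU := measurable_funeM qu%:E mdU.
  have mzD := measurable_funeM qd%:E mdD.
  rewrite stU stD -rE -zU -zD -ge0_integralD//; last first.
  rewrite -ge0_integralD//; last first.
  - exact: emeasurable_funD.
  - by move=> s _; exact: adde_ge0.
  apply: eq_integral => s _; rewrite /tame vanish_on_notin// /B -!EFinM -!EFinD.
  by congr (_%:E); ring.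
have runE : (\int[lam]_s (running_cost (s, w))%:E =
   \int[lam]_s (phi s)%:E + e%:E * \int[lam]_s (tame B s w)%:E)%E.
  rewrite -ge0_integralZl//.
  - rewrite -ge0_integralD//.
    + by move=> s _; rewrite lee_fin.
    + exact/measurable_EFinP.
    + by move=> s _; rewrite -EFinM lee_fin mulr_ge0 ?(ltW e0).
    + by apply/measurable_EFinP; exact: measurable_funM.
  - exact/measurable_EFinP.
  - by move=> s _; rewrite lee_fin.
  - by rewrite lee_fin ltW.
rewrite /path_cost run runE bE.
have i0 : (0 <= \int[lam]_s (phi s)%:E)%E by apply: integral_ge0 => s _; rewrite lee_fin.
have s1 : (0 <= qu%:E * stieltjes_integral (U ^~ w) (fun s => expR (- e * s)))%E.
  by rewrite stU mule_ge0 ?lee_fin ?(ltW qu0)//; apply: integral_ge0 => s _; rewrite lee_fin.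
have s2 : (0 <= qd%:E * stieltjes_integral (D ^~ w) (fun s => expR (- e * s)))%E.
  by rewrite stD mule_ge0 ?lee_fin ?(ltW qd0)//; apply: integral_ge0 => s _; rewrite lee_fin.
rewrite -2!addeA; set b := (X in (_ + X = _)%E).
rewrite -[X in (e%:E * X)%E]addeA -/b.
have b0 : (0 <= b)%E by rewrite !adde_ge0// lee_fin.
have eb0 : (0 <= e%:E * b)%E by rewrite mule_ge0// lee_fin ltW.
rewrite (ge0_muleDr _ i0 eb0) muleA -EFinM mulVf ?gt_eqF// mul1e.
by rewrite addeAC.
Qed.

(** This covers the sample points of [N], where the paths have no regularity: the Stieltjes
    integrals are nonnegative there too, being integrals against a measure or the default 0. *)
Lemma path_cost_ge w : (- (delta / e)%:E <= path_cost w)%E.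
Proof.
have st0 (g h : R -> R) : (forall s, 0 <= h s) -> (0 <= stieltjes_integral g h)%E.
  move=> h0; rewrite /stieltjes_integral; case: pselect => [H|] //.
  by apply: integral_ge0 => s _; rewrite lee_fin.
have hexp s : 0 <= expR (- e * s) by exact: expR_ge0.
have p1 : (0 <= qu%:E * stieltjes_integral (U ^~ w) (fun s => expR (- e * s)))%E.
  by rewrite mule_ge0 ?st0// lee_fin ltW.
have p2 : (0 <= qd%:E * stieltjes_integral (D ^~ w) (fun s => expR (- e * s)))%E.
  by rewrite mule_ge0 ?st0// lee_fin ltW.
have p3 : (0 <= (qu * U 0 w + qd * D 0 w)%:E)%E.
  by rewrite lee_fin addr_ge0// mulr_ge0 ?(ltW qu0) ?(ltW qd0) ?U_ge0 ?D_ge0.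
rewrite /path_cost -2!addeA.
apply: le_trans (leeDl _ (adde_ge0 p1 (adde_ge0 p2 p3))).
rewrite -discount_delta -integral_ge0N; last first.
  by move=> s _; rewrite lee_fin mulr_ge0 ?expR_ge0 ?(ltW delta0).
rewrite integral_mkcond [leRHS]integral_mkcond; apply: le_integral_pointwise => s.
rewrite !patchE; case: ifP => // _.
rewrite -EFinN lee_fin -mulrN ler_wpM2l ?expR_ge0//; exact: c_ge.
Qed.

Lemma verification : ((u x)%:E <= discounted_cost (P x) X e qu qd c U D)%E.
Proof.
pose J w := (\int[lam]_s (running_cost (s, w))%:E)%E.
have mR : measurable_fun setT (EFin \o running_cost).
  by apply/measurable_EFinP; exact: measurable_running_cost.
have R0 p : (0 <= (EFin \o running_cost) p)%E by rewrite lee_fin running_cost_ge0.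
have mJ : measurable_fun setT J.
  exact: (measurable_fun_fubini_tonelli_G (m1 := lam) (EFin \o running_cost)).
have J0 w : (0 <= J w)%E by apply: integral_ge0 => s _; exact: R0.
have JPi : (\int[P x]_w J w = \int[Pi]_p (running_cost p)%:E)%E.
  by rewrite (fubini_tonelli2 (m1 := lam) (m2 := P x) (EFin \o running_cost)).
(* A measurable minorant: [Z] minus [delta / e] equals the path cost off [N] and lies below it on
   [N], so the integrals compare pointwise without measurability of the path cost. *)
pose Z w := ((e^-1)%:E * (J w * (\1_(~` N) w)%:E))%E.
have mJN : measurable_fun setT (fun w => J w * (\1_(~` N) w)%:E)%E.
  apply: emeasurable_funM => //; apply/measurable_EFinP.
  by apply: measurable_indic; exact: measurableC.
have mZ : measurable_fun setT Z by exact: measurable_funeM.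
have Z0 w : (0 <= Z w)%E by rewrite !mule_ge0 ?lee_fin ?invr_ge0 ?(ltW e0).
have ZE : (\int[P x]_w Z w = (e^-1)%:E * \int[Pi]_p (running_cost p)%:E)%E.
  rewrite ge0_integralZl// ?lee_fin ?invr_ge0 ?(ltW e0)//; last first.
    by move=> w _; rewrite mule_ge0 ?lee_fin.
  rewrite -JPi; congr (_ * _)%E; apply: ge0_ae_eq_integral => //.
    by move=> w _; rewrite mule_ge0 ?lee_fin.
  exists N; split => //= w /= H; apply: contrapT => Nw; apply: H => _.
  by rewrite indicE mem_set// mule1.
have lower : (\int[P x]_w (Z w - (delta / e)%:E) <= \int[P x]_w path_cost w)%E.
  apply: le_integral_pointwise => w; have [Nw|Nw] := pselect (N w).
    rewrite /Z indicE memNset ?mule0 ?add0e; last by move=> /=; exact.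
    exact: path_cost_ge.
  by rewrite path_costE// /Z indicE mem_set// mule1.
apply: le_trans lower.
have de0 : 0 <= delta / e by rewrite divr_ge0 ?(ltW delta0) ?(ltW e0).
rewrite (ge0_integralB_integrable (k := cst (delta / e)))//; last first.
  exact: finite_measure_integrable_cst.
rewrite -[X in (_ - X)%E]/(\int[P x]_w (cst (delta / e)%:E w))%E integral_cst//.
rewrite [X in (_ - _ * X)%E](@probability_setT _ _ _ (P x)) mule1.
rewrite ZE.
have [Joo|Jfin] := eqVneq (\int[Pi]_p (running_cost p)%:E)%E +oo%E.
  by rewrite Joo gt0_muley ?lte_fin ?invr_gt0// addye// leey.
have iH : Pi.-integrable setT (EFin \o running_cost).
  apply/integrableP; split => //.
  under eq_integral do rewrite gee0_abs//.
  by rewrite ltey.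
have := verification_product iH.
have Ifin : (\int[Pi]_p (running_cost p)%:E)%E \is a fin_num by exact: integrable_fin_num iH.
rewrite -(fineK Ifin) -/(Rintegral _ _ _) => H.
rewrite -EFinM -EFinB lee_fin lerBrDr ler_pdivlMl//.
by rewrite mulrDr [e * (delta / e)]mulrCA mulfV ?gt_eqF// mulr1.
Qed.

End verification.

Theorem theorem5 (R : realType) (d : measure_display)
    (Omega : measurableType d) (P : R -> probability Omega R)
    (F : R -> set (set Omega)) (X : R -> Omega -> R)
    (qu qd eps delta : R) (c cdelta u : R -> R)
    (hF : filtration P F) (hX : levy_process P F X) (hmean : finite_mean P X)
    (hqu : 0 < qu) (hqd : 0 < qd) (heps : 0 < eps) (hdelta : 0 < delta)
    (hc : cost_function P X c)
    (hcdelta : associated_function P X c delta cdelta)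
    (hu_convex : convex_on_R u)
    (hu_domain : in_generator_domain P X u)
    (hu_ineq : forall x : R, 0 <= generator P X u x - eps * u x + cdelta x)
    (hu_slope : forall x : R, - qu <= derive1 u x <= qd)
    (hu_linear : linear_outside_some_itv u)
    (hu_C2 : ~ has_bounded_variation P X -> class_C 2 u)
    (hu_C1 : has_bounded_variation P X -> class_C 1 u) :
  forall (x : R) (U D : R -> Omega -> R),
    admissible_control F (P x) U D ->
    (\int[P x]_w \int[lebesgue_measure]_(s in `[0%R, +oo[)
       (expR (- eps * s) * u (controlled_process X U D s w))%:E < +oo)%E ->
    ((u x)%:E <= discounted_cost (P x) X eps qu qd cdelta U D)%E.
Proof.
move=> x U D [hU hD] _.
have du y : derivable u y 1.
  have [/hu_C1|/hu_C2] := pselect (has_bounded_variation P X).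
    by move=> [/(_ 0%N isT)].
  by move=> [/(_ 0%N isT)].
have mc : measurable_fun setT cdelta.
  by apply: measurable_derivable => y; have [/(_ 0%N isT)] := associated_C2 hcdelta.
(* [cdelta] is within [delta] of the nonnegative [c]; this is the origin of the shift by [delta] in
   the running cost. *)
have c_ge y : - delta <= cdelta y.
  have : (`|c y - cdelta y|%:E < delta%:E)%E.
    apply: le_lt_trans (associated_close hcdelta).
    by apply: ereal_sup_ubound; exists y.
  have := cost_ge0 hc y; rewrite lte_fin => c0 /ltW.
  rewrite ler_norml => /andP[_]; rewrite lerBlDr => /(le_trans c0).
  by rewrite -lerBlDl sub0r.
have rc : {ae P x, forall w, X 0 w = x /\ right_continuous_path (X ^~ w)}.
  have := levy_cadlag hX x; have := levy_start hX x.
  by apply: filterS2 => w X0 [rcX _].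
(* One measurable null set is extracted for the starting point and all path properties at once; it
   is the set on which the processes are later zeroed. *)
have good : {ae P x, forall w,
    (X 0 w = x /\ right_continuous_path (X ^~ w)) /\
    (right_continuous_path (U ^~ w) /\ right_continuous_path (D ^~ w)) /\
    (nondecreasing_path (U ^~ w) /\ nondecreasing_path (D ^~ w))}.
  have rcUD : {ae P x, forall w, right_continuous_path (U ^~ w) /\
      right_continuous_path (D ^~ w)}.
    by apply: filterS2 (control_right_continuous hU) (control_right_continuous hD).
  have ndUD : {ae P x, forall w, nondecreasing_path (U ^~ w) /\
      nondecreasing_path (D ^~ w)}.
    by apply: filterS2 (control_nondecreasing hU) (control_nondecreasing hD).
  by apply: filterS3 rc rcUD ndUD.
have [N [mN PN sub]] := good.
have {}good w : ~ N w -> (X 0 w = x /\ right_continuous_path (X ^~ w)) /\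
    (right_continuous_path (U ^~ w) /\ right_continuous_path (D ^~ w)) /\
    (nondecreasing_path (U ^~ w) /\ nondecreasing_path (D ^~ w)).
  by move=> Nw; apply: contrapT => H; apply: Nw; exact: sub.
apply: (verification hF hX hmean hu_convex du hqu hqd heps hdelta hu_slope hu_domain
  hu_ineq mc c_ge hU hD mN PN) => w /good.
- by move=> [[]].
- by move=> [[]].
- by move=> [_ [[]]].
- by move=> [_ [[]]].
- by move=> [_ [_ []]].
- by move=> [_ [_ []]].
Qed.
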